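(* Let $T$ be the tetrahedron with vertices $A=(0,0,0)$, $B=(1,0,0)$, $C=(0,1,0)$, $D=(0,0,6)$, with floor the triangle $ABC$. Let $(u_n)_{n\geq0}$ be defined by $u_0=1$ and, for $n\geq1$, \[u_n=\frac{6}{(n+2)(n+1)n}\sum_{k=0}^{n-1}u_k\,u_{n-1-k}.\] Then $Q_T(n)\leq u_n$ for all $n\geq0$.
   Context: $Q_T(n)$ is the probability that $n$ independent uniform random points $U_1,\dots,U_n$ in $T$ all lie on the boundary of ${\sf CH}(\{U_1,\dots,U_n\}\cup ABC)$ (where $ABC$ denotes the filled triangle), with $Q_T(0)=1$. *)

(* Defs.v *)
From HB Require Import structures.
From mathcomp Require Import all_boot all_order all_algebra.
From mathcomp Require Import all_classical all_reals all_analysis.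
Import Order.TTheory GRing.Theory Num.Theory.
Import numFieldNormedType.Exports.

Set Implicit Arguments.
Unset Strict Implicit.
Unset Printing Implicit Defensive.

Local Open Scope classical_set_scope.
Local Open Scope ring_scope.

Definition boundary (X : topologicalType) (A : set X) : set X :=
  closure A `\` interior A.

Definition convex_hull (R : numDomainType) (M : lmodType R) (A : set M) :
  set M := smallest (@convex_set R M) A.

(* Euclidean 3-space; its product topology and product sigma-algebra are the
   usual topology and the Borel sets. *)
Notation space3 R := (R * R * R)%type.

Definition volume (R : realType) : set (space3 R) -> \bar R :=
  (@lebesgue_measure R \x @lebesgue_measure R \x @lebesgue_measure R)%E.

Definition vertexA (R : realType) : space3 R := (0, 0, 0).
Definition vertexB (R : realType) : space3 R := (1, 0, 0).
Definition vertexC (R : realType) : space3 R := (0, 1, 0).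
Definition vertexD (R : realType) : space3 R := (0, 0, 6).

Definition tetrahedron (R : realType) : set (space3 R) :=
  convex_hull [set vertexA R; vertexB R; vertexC R; vertexD R].
Arguments tetrahedron R : clear implicits.

Definition floorABC (R : realType) : set (space3 R) :=
  convex_hull [set vertexA R; vertexB R; vertexC R].
Arguments floorABC R : clear implicits.

Definition independent (d d' : measure_display) (Omega : measurableType d)
    (X : measurableType d') (R : realType) (P : probability Omega R)
    (I : finType) (U : I -> {RV P >-> X}) : Prop :=
  forall (J : {set I}) (A : I -> set X),
    (forall i, i \in J -> measurable (A i)) ->
    P (\bigcap_(i in [set` J]) (U i @^-1` A i)) =
      (\prod_(i in J) P (U i @^-1` A i))%E.
Arguments independent {d d' Omega X R} P {I} U.

Definition uniform_on (d : measure_display) (Omega : measurableType d)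
    (R : realType) (P : probability Omega R) (K : set (space3 R))
    (X : {RV P >-> space3 R}) : Prop :=
  forall A : set (space3 R), measurable A ->
    distribution P X A = (volume (A `&` K) / volume K)%E.
Arguments uniform_on {d Omega R} P K X.

(* For n = 0 the event is the whole sample space, so Q_T P U = 1. *)
Definition Q_T (d : measure_display) (Omega : measurableType d)
    (R : realType) (P : probability Omega R) (n : nat)
    (U : 'I_n -> {RV P >-> space3 R}) : \bar R :=
  P [set w | forall i : 'I_n,
       boundary (convex_hull ([set U j w | j in [set: 'I_n]] `|` floorABC R))
                (U i w)].
Arguments Q_T {d Omega R} P {n} U.

(* Main.v *)
Require Import Defs.
From HB Require Import structures.
From mathcomp Require Import all_boot all_order all_algebra.
From mathcomp Require Import all_classical all_reals all_analysis.
From mathcomp Require Import measurable_realfun ring lra zify.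
Import Order.TTheory GRing.Theory Num.Theory.
Import numFieldNormedType.Exports.

Set Implicit Arguments.
Unset Strict Implicit.
Unset Printing Implicit Defensive.

Local Open Scope classical_set_scope.
Local Open Scope ring_scope.

(* Among the points, let X maximise the angle of the plane through the edge BC
   and the point, measured from the floor, and let Y be the point where this
   extremal plane meets the edge AD. All points lie in ABCY, and convex position
   excludes the interior of ABCX; hence, almost surely, the others are split
   between the tetrahedra ABXY and AXCY, where they are in convex position with
   respect to the floors ABX and AXC. For X = (p, q, s) these two tetrahedra have
   relative volumes q r and p r with r = s / (6 (1 - p - q)), so that, with
   k + l = n - 1, affine invariance and independence bound the probability by
   n C(n-1, k) E[(q r)^k (p r)^l] Q(k) Q(l) summed over k. The expectation is
   6 k! l! / (n (n+2)!), which gives the recursion defining u. *)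

(** * Convex hulls and interiors *)

(** Only an inequality comes out because convex position inside ABXY and inside AXCY is necessary
    but not sufficient: a point of one piece may be interior to a hull that uses points of both.
    Conditioning shapes the proof. Given X, the points falling in a piece must again be independent
    and uniform, so the induction hypothesis ranges over all probabilities on the sample space and
    all families with the product law. Conditional laws are normalised restrictions, and X is frozen
    by drawing the other points from a second copy of the sample space. The events must also be
    measurable although they speak of interiors of random hulls; this is why interiors of convex
    sets are reduced to sign conditions with countably many weights. The height 6 of D makes the
    volume of T equal to 1. The factor n C(n-1, k) 6 k! l! / (n (n+2)!) collapses to 6 /
    ((n+2)(n+1)n) for every k, which is the constant of the recursion. *)

Section convexity.
Context {R : realFieldType} {V : lmodType R}.
Implicit Types (A K : set V).

Lemma convex_setE K : @convex_set R V K <->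
  forall x y (t : R), 0 <= t <= 1 -> K x -> K y -> K (t *: x + (1 - t) *: y).
Proof.
split=> [cK x y t t01 Kx Ky|cK x y t].
  have := cK x y (Itv01 (andP t01).1 (andP t01).2).
  by rewrite !inE => /(_ Kx Ky).
rewrite !inE => Kx Ky; apply: cK => //.
by apply/andP; split; [exact: ge0|exact: le1].
Qed.

Lemma convex_hull_convex A : @convex_set R V (convex_hull A).
Proof.
apply/convex_setE => x y t t01 Hx Hy K [cK AK].
by move/convex_setE: (cK); apply => //; [apply: Hx|apply: Hy].
Qed.

Lemma sub_convex_hull A : A `<=` convex_hull A.
Proof. exact: sub_gen_smallest. Qed.

Lemma convex_hull_min A K : @convex_set R V K -> A `<=` K ->
  convex_hull A `<=` K.
Proof. by move=> cK AK; exact: smallest_sub. Qed.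

(** Writing the sum as its total weight times a point of [K], instead of dividing by the total,
    makes the property additive and covers total weight 0, where any point of [K] serves. *)
Lemma convex_cone (T : Type) (r : seq T) (P : pred T) K (c : T -> R) (x : T -> V) :
  @convex_set R V K -> (exists k, K k) ->
  (forall t, P t -> 0 <= c t) -> (forall t, P t -> K (x t)) ->
  exists2 k, K k & \sum_(t <- r | P t) c t *: x t =
                   (\sum_(t <- r | P t) c t) *: k.
Proof.
move=> /convex_setE cK [k0 Kk0] c0 Kx.
suff: 0 <= \sum_(t <- r | P t) c t /\ exists2 k, K k &
    \sum_(t <- r | P t) c t *: x t = (\sum_(t <- r | P t) c t) *: k by case.
apply: (big_ind2 (fun (v : V) (n : R) => 0 <= n /\ exists2 k, K k & v = n *: k)).
- by split=> //; exists k0; rewrite ?scale0r.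
- move=> _ a _ b [a0 [k Kk ->]] [b0 [l Kl ->]]; split; first exact: addr_ge0.
  have := addr_ge0 a0 b0; rewrite le_eqVlt => /predU1P[/esym/eqP|ab0].
    rewrite paddr_eq0// => /andP[/eqP-> /eqP->]; exists k => //.
    by rewrite addr0 !scale0r addr0.
  exists (a / (a + b) *: k + (1 - a / (a + b)) *: l).
    apply: cK => //; apply/andP; split; first by rewrite divr_ge0// ltW.
    by rewrite ler_pdivrMr// mul1r lerDl.
  have ab : a + b != 0 by rewrite gt_eqF.
  rewrite scalerDr !scalerA; congr (_ *: _ + _ *: _); by field.
- by move=> t Pt; split; [exact: c0|exists (x t) => //; exact: Kx].
Qed.

Lemma convex_hull_weighted (T : finType) (x : T -> V) (L : {set T}) (c : T -> R) :
  (forall t, 0 <= c t) -> 0 < \sum_(t in L) c t ->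
  convex_hull [set x t | t in [set` L]]
    ((\sum_(t in L) c t)^-1 *: \sum_(t in L) c t *: x t).
Proof.
move=> c0 S0; set S := \sum_(t in L) c t.
have [t tL] : exists t, t \in L.
  apply/existsP; apply: contraTT S0; rewrite negb_exists => /forallP L0.
  by rewrite big_pred0 ?ltxx// => t; apply/negbTE/L0.
have [|||k Kk ->] := @convex_cone T (index_enum T) (mem L)
    (convex_hull [set x t | t in [set` L]]) c x (@convex_hull_convex _).
- by exists (x t); apply: sub_convex_hull; exists t.
- by move=> u _; exact: c0.
- by move=> u uL; apply: sub_convex_hull; exists u.
by rewrite scalerA mulVf ?gt_eqF// scale1r.
Qed.

Lemma convex_hull_imageP (T : finType) (x : T -> V) (L : {set T}) y :
  convex_hull [set x t | t in [set` L]] y ->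
  exists c : T -> R, [/\ forall t, 0 <= c t, \sum_(t in L) c t = 1 &
    y = \sum_(t in L) c t *: x t].
Proof.
move: y; apply: convex_hull_min.
  apply/convex_setE => _ _ t /andP[t0 t1] [c [c0 c1 ->]] [e [e0 e1 ->]].
  exists (fun i => t * c i + (1 - t) * e i); split.
  - by move=> i; rewrite addr_ge0// mulr_ge0// subr_ge0.
  - by rewrite big_split/= -!mulr_sumr c1 e1 !mulr1 addrC subrK.
  - rewrite !scaler_sumr -big_split/=; apply: eq_bigr => i _.
    by rewrite [RHS]scalerDl !scalerA.
move=> _ [t tL <-]; exists (fun u => (u == t)%:R); split=> //.
- by rewrite (bigD1 t)//= eqxx big1 ?addr0// => u /andP[_ /negbTE->].
- rewrite (bigD1 t)//= eqxx scale1r big1 ?addr0// => u /andP[_ /negbTE->].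
  by rewrite scale0r.
Qed.

End convexity.

(** * Interiors of convex sets through orthants *)

Section orthants.
Context {R : realType}.
Implicit Types (K : set (space3 R)) (v w y : space3 R) (s : bool * bool * bool).

Lemma space3D v w :
  ((v + w).1.1 = v.1.1 + w.1.1) * ((v + w).1.2 = v.1.2 + w.1.2) *
  ((v + w).2 = v.2 + w.2).
Proof. by []. Qed.

Lemma space3N v :
  ((- v).1.1 = - v.1.1) * ((- v).1.2 = - v.1.2) * ((- v).2 = - v.2).
Proof. by []. Qed.

Lemma space3Z (t : R) v :
  ((t *: v).1.1 = t * v.1.1) * ((t *: v).1.2 = t * v.1.2) *
  ((t *: v).2 = t * v.2).
Proof. by []. Qed.

Definition space3E := (space3D, space3N, space3Z).

Lemma space3_eq v w :
  v.1.1 = w.1.1 -> v.1.2 = w.1.2 -> v.2 = w.2 -> v = w.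
Proof. by case: v w => [[? ?] ?] [[? ?] ?]/= -> -> ->. Qed.

(** A component [true] of [s] selects the negative side. Strictness makes the eight orthants open
    and keeps 0 out of each. *)
Definition in_orthant s v :=
  [/\ 0 < (-1) ^+ s.1.1 * v.1.1, 0 < (-1) ^+ s.1.2 * v.1.2 &
      0 < (-1) ^+ s.2 * v.2].

Lemma sign_balance (a b : R) : 0 < a -> 0 < -b ->
  exists t, 0 <= t <= 1 /\ t * a + (1 - t) * b = 0.
Proof.
move=> a0 b0; exists (- b / (a - b)).
have ab : 0 < a - b by rewrite addr_gt0.
have ab0 : a - b != 0 by rewrite gt_eqF.
split; last by field.
apply/andP; split; first by rewrite divr_ge0// ltW.
by rewrite ler_pdivrMr// mul1r -subr_ge0 opprK subrK ltW.
Qed.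

Lemma sign_mix (e : bool) (a b t : R) : 0 <= t <= 1 ->
  0 < (-1) ^+ e * a -> 0 < (-1) ^+ e * b ->
  0 < (-1) ^+ e * (t * a + (1 - t) * b).
Proof.
move=> /andP[t0 t1] a0 b0; rewrite mulrDr mulrCA [X in _ + X]mulrCA.
have [->|tn0] := eqVneq t 0; first by rewrite mul0r add0r subr0 mul1r.
apply: ltr_pwDl; first by rewrite mulr_gt0// lt_neqAle eq_sym tn0.
by rewrite mulr_ge0 ?subr_ge0// ltW.
Qed.

(* Cancelling one coordinate at a time: a segment joining two points on opposite
   sides of a coordinate plane through [w] meets it, with the other signs kept. *)
Lemma convex_orthants K w : @convex_set R (space3 R) K ->
  (forall s, exists2 y, K y & in_orthant s (y - w)) -> K w.
Proof.
move=> /convex_setE cK H.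
have H1 (s2 s3 : bool) : exists y, [/\ K y, y.1.1 - w.1.1 = 0,
    0 < (-1) ^+ s2 * (y.1.2 - w.1.2) & 0 < (-1) ^+ s3 * (y.2 - w.2)].
  have [y Ky [/= + y2 y3]] := H (false, s2, s3).
  have [z Kz [/= + z2 z3]] := H (true, s2, s3).
  rewrite expr0 expr1 mul1r mulN1r => z1 y1.
  have [t [t01 tE]] := sign_balance y1 z1.
  exists (t *: y + (1 - t) *: z); split; first exact: cK.
  - by rewrite -[RHS]tE !space3E; ring.
  - rewrite (_ : _ - _ = t * (y.1.2 - w.1.2) + (1 - t) * (z.1.2 - w.1.2)).
      exact: sign_mix.
    by rewrite !space3E; ring.
  - rewrite (_ : _ - _ = t * (y.2 - w.2) + (1 - t) * (z.2 - w.2)).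
      exact: sign_mix.
    by rewrite !space3E; ring.
have H2 (s3 : bool) : exists y, [/\ K y, y.1.1 - w.1.1 = 0, y.1.2 - w.1.2 = 0
    & 0 < (-1) ^+ s3 * (y.2 - w.2)].
  have [y [Ky y1 + y3]] := H1 false s3.
  have [z [Kz z1 + z3]] := H1 true s3.
  rewrite expr0 expr1 mul1r mulN1r => z2 y2.
  have [t [t01 tE]] := sign_balance y2 z2.
  exists (t *: y + (1 - t) *: z); split; first exact: cK.
  - rewrite (_ : _ - _ = t * (y.1.1 - w.1.1) + (1 - t) * (z.1.1 - w.1.1)).
      by rewrite y1 z1 !mulr0 addr0.
    by rewrite !space3E; ring.
  - by rewrite -[RHS]tE !space3E; ring.
  - rewrite (_ : _ - _ = t * (y.2 - w.2) + (1 - t) * (z.2 - w.2)).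
      exact: sign_mix.
    by rewrite !space3E; ring.
have [y [Ky y1 y2 +]] := H2 false.
have [z [Kz z1 z2 +]] := H2 true.
rewrite expr0 expr1 mul1r mulN1r => z3 y3.
have [t [t01 tE]] := sign_balance y3 z3.
rewrite (_ : w = t *: y + (1 - t) *: z); first exact: cK.
apply: space3_eq; rewrite !space3E.
- by rewrite (subr0_eq y1) (subr0_eq z1); ring.
- by rewrite (subr0_eq y2) (subr0_eq z2); ring.
- by rewrite -[LHS]addr0 -tE; ring.
Qed.

Lemma open_in_orthant s : open [set v : space3 R | in_orthant s v].
Proof.
have mc (e : bool) (f : space3 R -> R) : continuous f ->
    open [set v | 0 < (-1) ^+ e * f v].
  move=> cf; apply: (@open_comp _ _ (fun v => (-1) ^+ e * f v) [set r | 0 < r]).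
    by move=> v _; apply: cvgM; [exact: cvg_cst|exact: cf].
  exact: open_gt.
rewrite (_ : [set v | _] = [set v | 0 < (-1) ^+ s.1.1 * v.1.1] `&`
  [set v | 0 < (-1) ^+ s.1.2 * v.1.2] `&` [set v | 0 < (-1) ^+ s.2 * v.2]).
  apply: openI; first apply: openI; apply: mc.
  - by move=> v; apply: continuous_comp; exact: cvg_fst.
  - by move=> v; apply: continuous_comp; [exact: cvg_fst|exact: cvg_snd].
  - by move=> v; exact: cvg_snd.
by apply/seteqP; split=> v /= => [[]|[[]]]; split.
Qed.

(** Left to right, a small cube around [w] has a corner in every orthant. Right to left, eight
    witnesses chosen for [w] still serve every nearby [u], because orthants are open, and
    [convex_orthants] puts each such [u] in [K]. *)
Lemma interior_convexP K w : @convex_set R (space3 R) K ->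
  interior K w <-> forall s, exists2 y, K y & in_orthant s (y - w).
Proof.
move=> cK; split=> [/nbhs_ballP[e /= e0 eK] s|H].
  pose h := e / 2; have h0 : 0 < h by rewrite divr_gt0.
  have he : h < e by rewrite /h; lra.
  have hs (b : bool) : `|h * (-1) ^+ b| < e.
    by rewrite normrM normrX normrN1 expr1n mulr1 gtr0_norm.
  exists (w + (h * (-1) ^+ s.1.1, h * (-1) ^+ s.1.2, h * (-1) ^+ s.2)).
    apply: eK; case: w => [[a b] c]; do ?split; rewrite /ball/=;
    by rewrite opprD addNKr normrN hs.
  rewrite addrC addKr; split=> /=; rewrite mulrCA -expr2 sqrr_sign mulr1//.
have : \forall u \near w, forall s, exists2 y, K y & in_orthant s (y - u).
  apply: (@filter_forall _ _ (fun s u => exists2 y, K y & in_orthant s (y - u))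
    (nbhs w)) => s.
  have [y Ky sy] := H s.
  apply: (filterS (P := [set u | in_orthant s (y - u)])).
    by move=> u /= su; exists y.
  have yw : y - u @[u --> w] --> y - w by apply: cvgB; [exact: cvg_cst|exact: cvg_id].
  apply: yw; apply: open_nbhs_nbhs; split; last exact: sy.
  exact: open_in_orthant.
by apply: filterS => u Hu; exact: convex_orthants.
Qed.
End orthants.

(** Flooring [N * c t] lowers the sum by at most the sum of the [|a t|], while [N] times the
    original sum grows without bound. All large [N] work, so that the three coordinates can later
    share one [N]. *)
Lemma truncn_weights (R : realType) (T : finType) (L : {set T}) (c a : T -> R) :
  (forall t, 0 <= c t) -> 0 < \sum_(t in L) c t * a t ->
  exists N0, forall N, (N0 <= N)%N ->
    0 < \sum_(t in L) (Num.truncn (N%:R * c t))%:R * a t.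
Proof.
move=> c0 S0; set S := \sum_(t in L) _ in S0.
set M := \sum_(t in L) `|a t|.
exists (Num.truncn (M / S)).+1 => N HN.
have MN : M < N%:R * S.
  rewrite -ltr_pdivrMr//; apply: lt_le_trans (truncnS_gt _) _.
  by rewrite ler_nat.
have : N%:R * S - M <= \sum_(t in L) (Num.truncn (N%:R * c t))%:R * a t.
  rewrite /S /M mulr_sumr -sumrB; apply: ler_sum => t _.
  have /truncn_itv/andP[h1 h2] : 0 <= N%:R * c t by rewrite mulr_ge0.
  rewrite -natr1 in h2.
  rewrite mulrA lerBlDr -lerBlDl -mulrBl (le_trans (ler_norm _))//.
  rewrite normrM ler_piMl//.
  by rewrite ger0_norm ?subr_ge0// lerBlDl ltW.
by apply: lt_le_trans; rewrite subr_gt0 MN.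
Qed.

Lemma measurable_lt_set (d : measure_display) (Z : measurableType d)
    (R : realType) (f g : Z -> R) :
  measurable_fun setT f -> measurable_fun setT g ->
  measurable [set z | f z < g z].
Proof.
move=> mf mg; have := measurable_fun_ltr mf mg measurableT (Y := [set true]).
by rewrite setTI; apply.
Qed.

Lemma measurable_le_set (d : measure_display) (Z : measurableType d)
    (R : realType) (f g : Z -> R) :
  measurable_fun setT f -> measurable_fun setT g ->
  measurable [set z | f z <= g z].
Proof.
move=> mf mg; have := measurable_fun_ler mf mg measurableT (Y := [set true]).
by rewrite setTI; apply.
Qed.

(** * Measurability of interiors of random hulls *)

Section interior_hull.
Context {R : realType} {T : finType}.
Implicit Types (L : {set T}) (x : T -> space3 R) (w : space3 R).

Lemma sum_space3 (I : Type) (r : seq I) (P : pred I) (f : I -> space3 R) :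
  ((\sum_(i <- r | P i) f i).1.1 = \sum_(i <- r | P i) (f i).1.1) *
  ((\sum_(i <- r | P i) f i).1.2 = \sum_(i <- r | P i) (f i).1.2) *
  ((\sum_(i <- r | P i) f i).2 = \sum_(i <- r | P i) (f i).2).
Proof.
split; first split.
- by rewrite (big_morph (fun v : space3 R => v.1.1) (id1 := 0) (op1 := +%R)).
- by rewrite (big_morph (fun v : space3 R => v.1.2) (id1 := 0) (op1 := +%R)).
- by rewrite (big_morph (fun v : space3 R => v.2) (id1 := 0) (op1 := +%R)).
Qed.

Lemma in_orthantZ s (k : R) (v : space3 R) :
  0 < k -> in_orthant s v -> in_orthant s (k *: v).
Proof.
by move=> k0 [v1 v2 v3]; split; rewrite !space3E mulrCA mulr_gt0.
Qed.

Lemma sum_translate L x w (c : T -> R) :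
  \sum_(t in L) c t *: (x t - w) =
  \sum_(t in L) c t *: x t - (\sum_(t in L) c t) *: w.
Proof.
by rewrite scaler_suml -sumrB; apply: eq_bigr => t _; rewrite scalerBr.
Qed.

(* The countability of the weights makes the interior condition measurable in
   [x] and [w]. *)
Lemma interior_hullP L x w :
  interior (convex_hull [set x t | t in [set` L]]) w <->
  forall s, exists c : {ffun T -> nat},
    in_orthant s (\sum_(t in L) (c t)%:R *: (x t - w)).
Proof.
rewrite interior_convexP; last exact: convex_hull_convex.
split=> H s.
  have [_ /convex_hull_imageP [c [c0 c1 ->]]] := H s.
  have -> : \sum_(t in L) c t *: x t - w = \sum_(t in L) c t *: (x t - w).
    by rewrite sum_translate c1 scale1r.
  case.
  rewrite !sum_space3 !mulr_sumr => s1 s2 s3.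
  have E (b : bool) (f : T -> R) : \sum_(t in L) (-1) ^+ b * (c t * f t) =
      \sum_(t in L) c t * ((-1) ^+ b * f t).
    by apply: eq_bigr => t _; rewrite mulrCA.
  move: s1 s2 s3; rewrite !E.
  move=> /(truncn_weights c0)[N1 h1] /(truncn_weights c0)[N2 h2].
  move=> /(truncn_weights c0)[N3 h3].
  (* One multiplier beyond all three thresholds yields integer weights that serve the three
     coordinates at once. *)
  pose N := (N1 + N2 + N3)%N.
  exists [ffun t => Num.truncn (N%:R * c t)].
  split; rewrite !sum_space3 !mulr_sumr.
  - under eq_bigr do rewrite ffunE space3Z mulrCA.
    by apply: h1; rewrite /N -addnA leq_addr.
  - under eq_bigr do rewrite ffunE space3Z mulrCA.
    by apply: h2; rewrite /N addnAC leq_addl.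
  - under eq_bigr do rewrite ffunE space3Z mulrCA.
    by apply: h3; rewrite /N leq_addl.
have [c] := H s; rewrite (sum_translate _ _ _ (fun t => (c t)%:R)).
have : 0 <= \sum_(t in L) (c t)%:R :> R by apply: sumr_ge0.
(* Total weight 0 would make the combination the zero vector, which lies in no open orthant; a
   positive total can be normalised. *)
rewrite le_eqVlt => /predU1P[/esym S0|S0].
  have c0 t : t \in L -> (c t)%:R = 0 :> R.
    by move=> tL; apply/eqP; have /eqP := S0; rewrite psumr_eq0// => /allP/(_ t);
       rewrite mem_index_enum tL; apply.
  rewrite S0 scale0r subr0 big1 ?sub0r; last by move=> t /c0 ->; rewrite scale0r.
  by move=> -[/=]; rewrite mulr0 ltxx.
move=> so; exists ((\sum_(t in L) (c t)%:R)^-1 *: \sum_(t in L) (c t)%:R *: x t).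
  by have := @convex_hull_weighted _ _ _ x L (fun t => (c t)%:R) (fun=> ler0n _ _) S0.
have -> : w = (\sum_(t in L) (c t)%:R)^-1 *: ((\sum_(t in L) (c t)%:R) *: w).
  by rewrite scalerA mulVf ?gt_eqF// scale1r.
by rewrite -scalerBr; apply: in_orthantZ; rewrite ?invr_gt0.
Qed.

Context (d : measure_display) (Z : measurableType d).

Lemma measurable_in_orthant s (f : Z -> space3 R) :
  measurable_fun setT f -> measurable [set z | in_orthant s (f z)].
Proof.
move=> mf.
have m1 : measurable_fun setT (fun z => (f z).1) by exact: measurableT_comp.
rewrite (_ : [set z | _] = [set z | 0 < (-1) ^+ s.1.1 * (f z).1.1] `&`
  [set z | 0 < (-1) ^+ s.1.2 * (f z).1.2] `&` [set z | 0 < (-1) ^+ s.2 * (f z).2]).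
  apply: measurableI; first apply: measurableI; apply: measurable_lt_set => //;
    apply: measurable_funM => //; exact: measurableT_comp.
by apply/seteqP; split=> v /= => [[]|[[]]]; split.
Qed.

Lemma measurable_interior_hull L (x : T -> Z -> space3 R) (w : Z -> space3 R) :
  (forall t, t \in L -> measurable_fun setT (x t)) -> measurable_fun setT w ->
  measurable [set z | interior (convex_hull [set x t z | t in [set` L]]) (w z)].
Proof.
move=> mx mw.
rewrite (_ : [set z | _] = \bigcap_(s in [set: bool * bool * bool])
    \bigcup_(c in [set: {ffun T -> nat}])
    [set z | in_orthant s (\sum_(t in L) (c t)%:R *: (x t z - w z))]).
  apply: fin_bigcap_measurable => // s _.
  apply: countable_bigcupT_measurable => // c.
  apply: measurable_in_orthant.
  have m1 f : measurable_fun setT f ->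
    measurable_fun [set: Z] (fun z => (f z : space3 R).1) by exact: measurableT_comp.
  have m2 f : measurable_fun setT f -> measurable_fun [set: Z] (fun z => (f z : space3 R).2)
    by exact: measurableT_comp.
  rewrite (_ : (fun _ => _) = fun z =>
     (\sum_(t in L) (c t)%:R * ((x t z).1.1 - (w z).1.1),
      \sum_(t in L) (c t)%:R * ((x t z).1.2 - (w z).1.2),
      \sum_(t in L) (c t)%:R * ((x t z).2 - (w z).2))).
    have mS (f : T -> Z -> R) (g : Z -> R) : measurable_fun setT g ->
        (forall t, t \in L -> measurable_fun setT (f t)) ->
        measurable_fun setT (fun z => \sum_(t in L) (c t)%:R * (f t z - g z)).
      move=> mg mf; under eq_fun do rewrite big_mkcond.
      apply: measurable_sum => t; case: (boolP (t \in L)) => // tL.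
      by apply: measurable_funM => //; apply: measurable_funB => //; exact: mf.
    apply: measurable_fun_pair; first apply: measurable_fun_pair.
    - apply: mS => [|t tL]; apply: (measurableT_comp measurable_fst); apply: m1 => //; exact: mx.
    - apply: mS => [|t tL]; apply: (measurableT_comp measurable_snd); apply: m1 => //; exact: mx.
    - apply: mS => [|t tL]; apply: m2 => //; exact: mx.
  apply/funext => z; apply: space3_eq => /=; rewrite sum_space3/=;
    exact: eq_bigr.
apply/seteqP; split => [z /= /interior_hullP H s _|z /= H].
  by have [c] := H s; exists c.
by apply/interior_hullP => s; have [c _] := H s I; exists c.
Qed.

End interior_hull.

(** * Volumes *)

Section lebesgue_affine.
Context {R : realType}.
Notation lam := (@lebesgue_measure R).
Implicit Types (a b : R) (A : set R).

Lemma measurable_affine a b : measurable_fun setT (fun x : R => a * x + b).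
Proof. by apply: measurable_funD => //; exact: measurable_funM. Qed.

(** The image of Lebesgue measure under x -> a x + b, scaled by a, gives every half-open interval
    its length, hence is Lebesgue measure by uniqueness. *)
Lemma lebesgue_measure_affine a b A : 0 < a -> measurable A ->
  lam ((fun x => a * x + b) @^-1` A) = (a^-1%:E * lam A)%E.
Proof.
move=> a0 mA.
pose f : measurableTypeR R -> measurableTypeR R := fun x => a * x + b.
have mf : measurable_fun setT f by exact: measurable_affine.
have -> : lam A = pushforward (mscale (NngNum (ltW a0)) lam) f A.
  apply: lebesgue_measure_unique => //= _ [[x y]] _ <-.
  rewrite /mscale /pushforward/=.
  rewrite (_ : f @^-1` _ = `](x - b) / a, (y - b) / a]%classic); last first.
    apply/seteqP; split=> z /=; rewrite !in_itv/= /f;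
    by rewrite ltr_pdivrMr// ler_pdivlMr// ltrBlDr lerBrDr mulrC.
  rewrite !lebesgue_measure_itv/= !lte_fin ltr_pM2r ?invr_gt0// ltrD2r.
  case: ifPn => xy; last by rewrite mule0.
  rewrite -!EFinD -EFinM -mulrBl opprB addrA subrK mulrC divfK//.
  by rewrite gt_eqF.
by rewrite /pushforward /mscale/= muleA -EFinM mulVf ?mul1e// gt_eqF.
Qed.

Lemma ge0_integral_affine a b (f : R -> \bar R) : 0 < a ->
  measurable_fun setT f -> (forall x, (0 <= f x)%E) ->
  (\int[lam]_x f (a * x + b)%R = a^-1%:E * \int[lam]_x f x)%E.
Proof.
move=> a0 mf f0.
pose h : measurableTypeR R -> measurableTypeR R := fun x => a * x + b.
have mh : measurable_fun setT h by exact: measurable_affine.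
have a0' : 0 <= a^-1 by rewrite invr_ge0 ltW.
transitivity (\int[pushforward lam h]_x f x)%E.
  by rewrite ge0_integral_pushforward.
rewrite (@eq_measure_integral _ _ _ _ (mscale (NngNum a0') lam)).
  by rewrite ge0_integral_mscale.
by move=> A mA _; exact: lebesgue_measure_affine.
Qed.

(** The substitution x = c y leads to the beta integral B(a+1, b+1) = a! b! / (a+b+1)!. The case c =
    0 is separate since the substitution divides by c. *)
Lemma integral_power_interval (c : R) (a b : nat) : 0 <= c ->
  (\int[lam]_(x in `[0%R, c]) (x ^+ a * (c - x) ^+ b)%:E =
   (c ^+ (a + b).+1 * (a`! * b`!)%:R / ((a + b).+1)`!%:R)%:E)%E.
Proof.
rewrite le_eqVlt => /predU1P[<-|c0].
  by rewrite set_itv1 integral_set1 exprS !mul0r.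
pose h x := (@XMonemX R a b \_`[0,1] x)%:E.
have mh : measurable_fun setT h.
  apply/measurable_EFinP/(measurable_restrictT _ _).1 => //.
  exact: measurable_XMonemX.
have h0 x : (0 <= h x)%E.
  rewrite lee_fin /h patchE; case: ifPn => //; rewrite inE => x01.
  exact: XMonemX_ge0.
transitivity (\int[lam]_x ((c ^+ (a + b))%:E * h (c^-1 * x + 0)%R))%E.
  rewrite integral_mkcond; apply: eq_integral => x _.
  rewrite /h !patchE addr0 !mem_setE !in_itv/= !pmulr_rge0 ?invr_gt0//.
  rewrite ![c^-1 * x]mulrC ler_pdivrMr// mul1r; case: ifPn => // _; last by rewrite mule0.
  rewrite -EFinM (_ : XMonemX a b (x / c) = (x / c) ^+ a * ((c - x) / c) ^+ b); last first.
    congr (_ * _ ^+ _); by rewrite mulrBl divff ?gt_eqF//.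
  rewrite !exprMn !exprVn exprD; congr EFin; field.
  by rewrite !expf_eq0 !gt_eqF// !andbF.
rewrite ge0_integralZl_EFin ?exprn_ge0 ?ltW//; last first.
  by apply: measurableT_comp => //; exact: measurable_affine.
rewrite ge0_integral_affine ?invr_gt0// invrK /h.
(* [beta_fun] takes the exponents shifted by one, hence the artificial [a.+1.-1]. *)
rewrite -[in LHS]/(a.+1.-1) -[in LHS]/(b.+1.-1) -EFin_beta_fun beta_fun_fact.
by rewrite -!EFinM exprS; congr EFin; ring.
Qed.

End lebesgue_affine.

Section product_sigma_finite.
Context d1 d2 (T1 : measurableType d1) (T2 : measurableType d2) (R : realType).
Variables (m1 : {sigma_finite_measure set T1 -> \bar R})
          (m2 : {sigma_finite_measure set T2 -> \bar R}).

Let product_sigma_finite : sigma_finite setT (m1 \x m2)%E.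
Proof.
have /sigma_finiteP[F [TF ndF Foo]] := sigma_finiteT m1.
have /sigma_finiteP[G [TG ndG Goo]] := sigma_finiteT m2.
exists (fun n => F n `*` G n); last first.
  move=> n; have [mF Fn] := Foo n; have [mG Gn] := Goo n.
  by split; [exact: measurableX|rewrite product_measure1E// lte_mul_pinfty// ge0_fin_numE].
apply/seteqP; split=> // -[x y] _.
have : (\bigcup_n F n) x /\ (\bigcup_n G n) y by rewrite -TF -TG.
move=> [[n _ Fx] [k _ Gy]]; exists (maxn n k) => //.
by split; [exact: (subsetPset _ _ (ndF _ _ (leq_maxl n k)))|
           exact: (subsetPset _ _ (ndG _ _ (leq_maxr n k)))].
Qed.

(* Not an instance: the key [product_measure1] is taken by subprobabilities. *)
Definition sigma_finite_product : {sigma_finite_measure set (T1 * T2)%type -> \bar R} :=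
  HB.pack (m1 \x m2)%E
    (Measure_isSigmaFinite.Build _ _ _ (m1 \x m2)%E product_sigma_finite).

End product_sigma_finite.

Section volume_measure.
Context {R : realType}.

Let lam3 := (@lebesgue_measure R \x @lebesgue_measure R \x @lebesgue_measure R)%E.

Let volume0 : @volume R set0 = 0%E.
Proof. exact: (measure0 lam3). Qed.

Let volume_ge0 A : (0 <= @volume R A)%E.
Proof. exact: (measure_ge0 lam3). Qed.

Let volume_semi_sigma_additive : semi_sigma_additive (@volume R).
Proof. exact: (@measure_semi_sigma_additive _ _ _ lam3). Qed.

(** [volume] is a bare set function; attaching the measure structure of the triple product to it
    lets monotonicity and subadditivity apply under that name. *)
HB.instance Definition _ := isMeasure.Build _ _ _ (@volume R)
  volume0 volume_ge0 volume_semi_sigma_additive.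

End volume_measure.

(** * Volumes under shears *)

Section volume_maps.
Context {R : realType}.
Notation lam := (@lebesgue_measure R).
Local Open Scope ereal_scope.

(** Cavalieri along vertical lines: the fibre over [v] is an affine image, stretched by [r], of the
    section of [A] above [h v]. What remains is a change of variables in the plane. *)
Lemma volume_vertical_affine (h : R * R -> R * R) (k : R * R -> R) (r : R)
    (A : set (space3 R)) :
  (0 < r)%R -> measurable_fun setT h -> measurable_fun setT k -> measurable A ->
  volume [set w | A (h w.1, (w.2 - k w.1) / r)%R] =
  r%:E * \int[lam \x lam]_v lam (xsection A (h v)).
Proof.
move=> r0 mh mk mA.
have mx : measurable_fun setT (fun v => lam (xsection A v)).
  exact: measurable_fun_xsection.
rewrite -ge0_integralZl_EFin//=; last 2 first.
- exact: (measurableT_comp mx mh).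
- exact: ltW.
rewrite /volume {1}/product_measure1; apply: eq_integral => v _ /=.
rewrite -[in RHS](invrK r) -(@lebesgue_measure_affine R r^-1 (- k v / r)) ?invr_gt0//.
  congr (lam _); apply/seteqP; split=> z; rewrite xsectionE/= xsectionE/=;
  by rewrite mulrBl mulNr [(r^-1 * z)%R]mulrC.
exact: measurable_xsection.
Qed.

(** With the second coordinate outermost, the inner substitution is a translation and the outer one
    a scaling by [q]. *)
Lemma integral_plane_shear1 (f : R * R -> \bar R) (p q : R) : (0 < q)%R ->
  measurable_fun setT f -> (forall v, 0 <= f v) ->
  \int[lam \x lam]_v f (v.1 - p * v.2 / q, v.2 / q)%R =
  q%:E * \int[lam \x lam]_v f v.
Proof.
move=> q0 mf f0.
pose g (v : R * R) := f (v.1 - p * v.2 / q, v.2 / q)%R.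
have mg : measurable_fun setT g.
  apply: measurableT_comp => //; apply: measurable_fun_pair.
    apply: measurable_funB => //; apply: measurable_funM => //.
    exact: measurable_funM.
  exact: measurable_funM.
rewrite -[LHS]/(\int[lam \x lam]_v g v) (@fubini_tonelli2 _ _ _ _ R lam lam g)//; last first.
  by move=> v; exact: f0.
rewrite (@fubini_tonelli2 _ _ _ _ R lam lam f)//.
have mG : measurable_fun setT (fubini_G lam f) by exact: measurable_fun_fubini_tonelli_G.
have G0 y : 0 <= fubini_G lam f y by apply: integral_ge0.
rewrite -[in q%:E](invrK q) -(@ge0_integral_affine _ _ 0) ?invr_gt0//.
apply: eq_integral => y _; rewrite /fubini_G addr0 /g.
transitivity (\int[lam]_x f (1 * x + - p * y / q, q^-1 * y)%R).
  by apply: eq_integral => x _; rewrite /= mul1r !mulNr [(y / q)%R]mulrC.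
rewrite (@ge0_integral_affine _ 1 _ (fun x => f (x, q^-1 * y)%R))//.
  by rewrite invr1 mul1e.
exact: measurableT_comp.
Qed.

Lemma integral_plane_shear2 (f : R * R -> \bar R) (p q : R) : (0 < p)%R ->
  measurable_fun setT f -> (forall v, 0 <= f v) ->
  \int[lam \x lam]_v f (v.1 / p, v.2 - q * v.1 / p)%R =
  p%:E * \int[lam \x lam]_v f v.
Proof.
move=> p0 mf f0.
pose g (v : R * R) := f (v.1 / p, v.2 - q * v.1 / p)%R.
have mg : measurable_fun setT g.
  apply: measurableT_comp => //; apply: measurable_fun_pair.
    exact: measurable_funM.
  apply: measurable_funB => //; apply: measurable_funM => //.
  exact: measurable_funM.
rewrite -[LHS]/(\int[lam \x lam]_v g v) (@fubini_tonelli1 _ _ _ _ R lam lam g)//; last first.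
  by move=> v; exact: f0.
rewrite (@fubini_tonelli1 _ _ _ _ R lam lam f)//.
have mG : measurable_fun setT (fubini_F lam f) by exact: measurable_fun_fubini_tonelli_F.
have G0 y : 0 <= fubini_F lam f y by apply: integral_ge0.
rewrite -[in p%:E](invrK p) -(@ge0_integral_affine _ _ 0) ?invr_gt0//.
apply: eq_integral => y _; rewrite /fubini_F addr0 /g.
transitivity (\int[lam]_x f (p^-1 * y, 1 * x + - q * y / p)%R).
  by apply: eq_integral => x _; rewrite /= mul1r !mulNr [(y / p)%R]mulrC.
rewrite (@ge0_integral_affine _ 1 _ (fun x => f (p^-1 * y, x)%R))//.
  by rewrite invr1 mul1e.
exact: measurableT_comp.
Qed.

(** For [x = (p, q, s)] of slope [r] the map is [coordsB x]. The factor [q * r] is the determinant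
    of its inverse, that is the volume of ABXY relative to ABCD. *)
Lemma volume_shear1 (p q s r : R) (A : set (space3 R)) :
  (0 < q)%R -> (0 < r)%R -> measurable A ->
  volume [set w | A (w.1.1 - p * w.1.2 / q, w.1.2 / q,
                     (w.2 - s * w.1.2 / q) / r)%R] = (q * r)%:E * volume A.
Proof.
move=> q0 r0 mA.
rewrite (@volume_vertical_affine
  (fun v : R * R => (v.1 - p * v.2 / q, v.2 / q)%R) (fun v : R * R => s * v.2 / q)%R)//.
- rewrite (@integral_plane_shear1 (fun v => lam (xsection A v)))//.
    by rewrite muleA -EFinM mulrC.
  exact: measurable_fun_xsection.
- apply: measurable_fun_pair.
    apply: measurable_funB => //; apply: measurable_funM => //.
    exact: measurable_funM.
  exact: measurable_funM.
- by apply: measurable_funM => //; exact: measurable_funM.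
Qed.

Lemma volume_shear2 (p q s r : R) (A : set (space3 R)) :
  (0 < p)%R -> (0 < r)%R -> measurable A ->
  volume [set w | A (w.1.1 / p, w.1.2 - q * w.1.1 / p,
                     (w.2 - s * w.1.1 / p) / r)%R] = (p * r)%:E * volume A.
Proof.
move=> p0 r0 mA.
rewrite (@volume_vertical_affine
  (fun v : R * R => (v.1 / p, v.2 - q * v.1 / p)%R) (fun v : R * R => s * v.1 / p)%R)//.
- rewrite (@integral_plane_shear2 (fun v => lam (xsection A v)))//.
    by rewrite muleA -EFinM mulrC.
  exact: measurable_fun_xsection.
- apply: measurable_fun_pair.
    exact: measurable_funM.
  apply: measurable_funB => //; apply: measurable_funM => //.
  exact: measurable_funM.
- by apply: measurable_funM => //; exact: measurable_funM.
Qed.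

Lemma volume_graph (h : R * R -> R) : volume [set w | w.2 = h w.1] = 0.
Proof.
rewrite /volume {1}/product_measure1 integral0_eq// => v _ /=.
rewrite (_ : xsection _ _ = [set h v]) ?lebesgue_measure_set1//.
by apply/seteqP; split=> z; rewrite xsectionE.
Qed.

Lemma volume_box (A B C : set R) : measurable A -> measurable B -> measurable C ->
  volume ((A `*` B) `*` C) = lam A * lam B * lam C.
Proof.
move=> mA mB mC.
have mAB : measurable (A `*` B) by exact: measurableX.
have -> : volume ((A `*` B) `*` C) = (lam \x lam) (A `*` B) * lam C.
  exact: (@product_measure1E _ _ _ _ R (lam \x lam) lam).
by congr (_ * _); exact: (@product_measure1E _ _ _ _ R lam lam).
Qed.

Lemma volume_side1 : volume [set w : space3 R | w.1.1 = 0%R] = 0.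
Proof.
rewrite (_ : [set _ | _] = ([set 0%R] `*` setT) `*` setT).
  by rewrite volume_box// lebesgue_measure_set1 !mul0e.
by apply/seteqP; split=> -[[x y] z] /=; [move=> ->|case; case].
Qed.

Lemma volume_side2 : volume [set w : space3 R | w.1.2 = 0%R] = 0.
Proof.
rewrite (_ : [set _ | _] = (setT `*` [set 0%R]) `*` setT).
  by rewrite volume_box// lebesgue_measure_set1 mule0 mul0e.
by apply/seteqP; split=> -[[x y] z] /=; [move=> ->|case; case].
Qed.

End volume_maps.

(** Continuity handles the complement of 0; on the remaining single point every function is
    measurable. *)
Lemma measurable_invr (R : realType) : measurable_fun setT (@GRing.inv R).
Proof.
rewrite -(setvU [set 0%R : R]); apply/measurable_funU => //.
  exact: measurableC.
split.
  apply: open_continuous_measurable_fun; first exact: closed_openC.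
  by move=> x; rewrite inE/= => /eqP x0; exact: inv_continuous.
exact: measurable_fun_set1.
Qed.

(** * The tetrahedron in coordinates and the slope integral *)

Section simplex.
Context {R : realType}.
Notation lam := (@lebesgue_measure R).

(** Facet description of T, identified with the hull of its vertices in [tetrahedronE]; sections and
    integrals are read off from it. *)
Definition simplex : set (space3 R) :=
  [set w | [/\ 0 <= w.1.1, 0 <= w.1.2, 0 <= w.2 & w.1.1 + w.1.2 + w.2 / 6 <= 1]].

Lemma measurable_coord1 : measurable_fun setT (fun w : space3 R => w.1.1).
Proof. exact: (measurableT_comp measurable_fst measurable_fst). Qed.

Lemma measurable_coord2 : measurable_fun setT (fun w : space3 R => w.1.2).
Proof. exact: (measurableT_comp measurable_snd measurable_fst). Qed.

Lemma measurable_coord3 : measurable_fun setT (fun w : space3 R => w.2).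
Proof. exact: measurable_snd. Qed.

Hint Resolve measurable_coord1 measurable_coord2 measurable_coord3 : core.

Lemma measurable_simplex : measurable simplex.
Proof.
rewrite (_ : simplex = [set w | 0 <= w.1.1] `&` [set w | 0 <= w.1.2] `&`
   [set w | 0 <= w.2] `&` [set w | w.1.1 + w.1.2 + w.2 / 6 <= 1]).
  apply: measurableI; first apply: measurableI; first apply: measurableI;
    apply: measurable_le_set => //.
  apply: measurable_funD; last exact: measurable_funM.
  exact: measurable_funD.
by apply/seteqP; split=> w /= => [[]|[[[]]]].
Qed.

(** For [w] in T off the edge BC, this is the ratio r of its height to that of the face BCD above
    it. The plane through B, C and [w] is z = 6 r (1 - x - y) and meets AD at (0, 0, 6 r), so
    maximising r maximises the angle with the floor. *)
Definition slope (w : space3 R) : R := w.2 / (6 * (1 - w.1.1 - w.1.2)).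

Lemma measurable_slope : measurable_fun setT slope.
Proof.
apply: measurable_funM => //; apply: (measurableT_comp (@measurable_invr R)).
apply: measurable_funM => //; apply: measurable_funB => //.
exact: measurable_funB.
Qed.

Local Open Scope ereal_scope.

(** Vertically, [slope] is s / c with c = 6 (1 - p - q), and its power of exponent k + l integrates
    over [0, c] to c / (k + l + 1). Two beta integrals remain, in q and then in p, with
    complementary factors 1 - p - q and (1 - p)^(k+2). *)
Lemma integral_simplex_slope (k l : nat) :
  \int[lam \x lam \x lam]_(w in simplex)
     (w.1.2 ^+ k * w.1.1 ^+ l * slope w ^+ (k + l))%:E =
  (6 * (k`! * l`!)%:R / ((k + l).+1%:R * (k + l + 3)`!%:R))%:E.
Proof.
set f := fun w : space3 R => (w.1.2 ^+ k * w.1.1 ^+ l * slope w ^+ (k + l))%R.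
have mf : measurable_fun setT f.
  apply: measurable_funM; last by apply: measurable_funX; exact: measurable_slope.
  by apply: measurable_funM; exact: measurable_funX.
have f0 w : simplex w -> (0 <= f w)%R.
  move=> [w1 w2 w3 w4]; rewrite /f /slope !mulr_ge0 ?exprn_ge0// divr_ge0//.
  by rewrite mulr_ge0// -addrA -opprD subr_ge0; lra.
rewrite integral_mkcond; set H := _ \_ _.
have mH : measurable_fun setT H.
  apply/(measurable_restrictT _ _).1; first exact: measurable_simplex.
  by apply/measurable_EFinP; exact: measurable_funS mf.
have H0 w : 0 <= H w.
  by rewrite /H patchE; case: ifPn => //; rewrite inE lee_fin; exact: f0.
transitivity (\int[lam \x lam]_v fubini_F lam H v).
  exact: (@fubini_tonelli1 _ _ _ _ R (sigma_finite_product lam lam) lam H).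
pose c (v : R * R) := (6 * (1 - v.1 - v.2))%R.
pose H2 (v : R * R) := if [&& (0 <= v.1)%R, (0 <= v.2)%R & (v.1 + v.2 <= 1)%R]
  then (v.2 ^+ k * v.1 ^+ l * (c v / (k + l).+1%:R))%:E else 0.
have FH : fubini_F lam H = H2.
  apply/funext => v; rewrite /fubini_F /H2.
  case: ifPn => [/and3P[v1 v2 v3]|vn]; last first.
    apply: integral0_eq => s _; rewrite /H patchE.
    case: ifPn => //; rewrite inE => -[/= w1 w2 w3 w4]; case/negP: vn.
    by rewrite w1 w2/=; lra.
  have c0 : (0 <= c v)%R by rewrite /c; lra.
  (* The factor [(c v - s) ^+ 0] casts the integrand in the shape of [integral_power_interval]. *)
  transitivity (\int[lam]_(s in `[0%R, c v])
     ((v.2 ^+ k * v.1 ^+ l * (c v)^-1 ^+ (k + l))%:E * (s ^+ (k + l) * (c v - s) ^+ 0)%:E)).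
    rewrite [RHS]integral_mkcond; apply: eq_integral => s _.
    rewrite /H !patchE !mem_setE/=.
    have -> : (v, s) \in simplex = (s \in `[0%R, c v]).
      rewrite in_itv/=; apply/idP/idP; rewrite inE.
        by move=> [/= _ _ -> w4]; rewrite /c; lra.
      by move=> /andP[s0 sc]; split=> //=; move: sc; rewrite /c; lra.
    case: ifPn => // _; rewrite -EFinM expr0 mulr1 /f/= /slope/= -/(c v).
    by rewrite exprMn; congr EFin; ring.
  rewrite ge0_integralZl_EFin//; last 3 first.
  - move=> s /=; rewrite in_itv/= => /andP[s0 _].
    by rewrite lee_fin expr0 mulr1 exprn_ge0.
  - by apply/measurable_EFinP; apply: measurable_funM => //.
  - by rewrite !mulr_ge0// exprn_ge0// invr_ge0.
  rewrite integral_power_interval// -EFinM; congr EFin.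
  rewrite fact0 muln1 addn0 factS natrM.
  (* On the edge BC, where [c v = 0], [field] does not apply, but both sides vanish. *)
  have [->|cn0] := eqVneq (c v) 0%R; first by rewrite exprS !(mul0r, mulr0).
  have X0 : (c v ^+ (k + l) != 0)%R by rewrite expf_neq0.
  have F0 : ((k + l)`!%:R != 0 :> R)%R by rewrite pnatr_eq0 -lt0n fact_gt0.
  have M0 : ((k + l).+1%:R != 0 :> R)%R by rewrite pnatr_eq0.
  rewrite exprVn exprS.
  move: (c v ^+ _)%R (_`!%:R)%R (_.+1%:R)%R X0 F0 M0 => X F M X0 F0 M0.
  by field; rewrite ?X0 ?F0 ?M0.
rewrite FH.
have H20 v : 0 <= H2 v.
  rewrite -FH; exact: integral_ge0.
have mH2 : measurable_fun setT H2.
  by rewrite -FH; exact: (@measurable_fun_fubini_tonelli_F _ _ _ _ R lam H).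
transitivity (\int[lam]_x fubini_F lam H2 x).
  exact: (@fubini_tonelli1 _ _ _ _ R lam lam H2).
transitivity (\int[lam]_(p in `[0%R, 1%R]) (
   (6 / (k + l).+1%:R / k.+2`!%:R * k`!%:R)%:E * (p ^+ l * (1 - p) ^+ k.+2)%:E)).
  rewrite [RHS]integral_mkcond; apply: eq_integral => p _.
  rewrite patchE mem_setE/= in_itv/= /fubini_F.
  case: ifPn => [/andP[p0 p1]|pn]; last first.
    apply: integral0_eq => q _; rewrite /H2/=; case: ifPn => // /and3P[p0 q0 pq].
    by case/negP: pn; rewrite p0/=; lra.
  have c0 : (0 <= 1 - p)%R by lra.
  transitivity (\int[lam]_(q in `[0%R, (1 - p)%R])
     ((6 * p ^+ l / (k + l).+1%:R)%:E * (q ^+ k * (1 - p - q) ^+ 1)%:E)).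
    rewrite [RHS]integral_mkcond; apply: eq_integral => q _.
    rewrite /H2 patchE mem_setE/= in_itv/= p0/= lerBrDl.
    case: ifPn => // _; rewrite -EFinM /c/=; congr EFin; ring.
  rewrite ge0_integralZl_EFin//; last 3 first.
  - move=> s /=; rewrite in_itv/= => /andP[s0 s1].
    by rewrite lee_fin mulr_ge0 ?exprn_ge0// subr_ge0.
  - apply/measurable_EFinP; apply: measurable_funM => //.
    by apply: measurable_funX; exact: measurable_funB.
  - by rewrite !mulr_ge0// ?exprn_ge0// invr_ge0.
  rewrite integral_power_interval// -!EFinM; congr EFin.
  have F0 : (k.+2`!%:R != 0 :> R)%R by rewrite pnatr_eq0 -lt0n fact_gt0.
  have M0 : ((k + l).+1%:R != 0 :> R)%R by rewrite pnatr_eq0.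
  rewrite addn1 muln1.
  move: (k.+2`!%:R)%R (_.+1%:R)%R F0 M0 => F M F0 M0.
  by field; rewrite ?F0 ?M0.
rewrite ge0_integralZl_EFin//; last 2 first.
- move=> s /=; rewrite in_itv/= => /andP[s0 s1].
  by rewrite lee_fin mulr_ge0 ?exprn_ge0// subr_ge0.
- apply/measurable_EFinP; apply: measurable_funM => //.
  by apply: measurable_funX; exact: measurable_funB.
rewrite integral_power_interval// -!EFinM; congr EFin.
rewrite expr1n (natrM _ l`!) (natrM _ k`!) (_ : (l + k.+2).+1 = (k + l + 3)%N); last by lia.
have F0 : (k.+2`!%:R != 0 :> R)%R by rewrite pnatr_eq0 -lt0n fact_gt0.
have G0 : ((k + l + 3)`!%:R != 0 :> R)%R by rewrite pnatr_eq0 -lt0n fact_gt0.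
have M0 : ((k + l).+1%:R != 0 :> R)%R by rewrite pnatr_eq0.
move: (k.+2`!%:R)%R ((k + l).+1%:R)%R ((k + l + 3)`!%:R)%R F0 M0 G0 => F M G F0 M0 G0.
by field; rewrite ?F0 ?M0 ?G0.
Qed.

(** The case k = l = 0 of the slope integral: 6 / 3! = 1. *)
Lemma volume_simplex : @volume R simplex = 1.
Proof.
have := integral_simplex_slope 0 0.
under eq_integral do rewrite !expr0 !mulr1.
rewrite integral_cst; last exact: measurable_simplex.
rewrite mul1e => ->; congr EFin.
by rewrite fact0 muln1 !add0n mul1r mulr1 (_ : 3`! = 6)%N// divff// pnatr_eq0.
Qed.

End simplex.

(** * Geometry of the tetrahedron *)

Section simplex_geometry.
Context {R : realType}.
Implicit Types (K S : set (space3 R)) (x w u v : space3 R).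

(** The origin is the vertex A and takes up the missing weight 1 - (a + b + c). *)
Lemma convex_combination3 K u v w (a b c : R) : @convex_set R (space3 R) K ->
  K 0 -> K u -> K v -> K w -> 0 <= a -> 0 <= b -> 0 <= c -> a + b + c <= 1 ->
  K (a *: u + b *: v + c *: w).
Proof.
move=> cK K0 Ku Kv Kw a0 b0 c0 abc; set d := 1 - (a + b + c).
have d0 : 0 <= d by rewrite subr_ge0.
(* [convex_cone] asks its side conditions of every index satisfying the predicate, so they are built
   into the predicate. *)
have [|||k Kk] := @convex_cone R (space3 R) _
  [:: (a, u); (b, v); (c, w); (d, 0)]
  [pred t | (0 <= t.1) && `[< K t.2 >]] K fst snd cK.
- by exists 0.
- by move=> t /andP[].
- by move=> t /andP[_ /asboolP].
rewrite !big_cons !big_nil /= a0 b0 c0 d0 !asboolT//= scaler0 !addr0.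
rewrite (_ : a + (b + (c + d)) = 1) ?scale1r ?addrA; last by rewrite /d; ring.
by move=> ->.
Qed.

Lemma simplex_convex : @convex_set R (space3 R) simplex.
Proof.
apply/convex_setE => u v t /andP[t0 t1] [u1 u2 u3 u4] [v1 v2 v3 v4].
split; rewrite !space3E; try by rewrite addr_ge0// mulr_ge0// subr_ge0.
have := ler_wpM2l t0 u4.
have t1' : 0 <= 1 - t by rewrite subr_ge0.
by have := ler_wpM2l t1' v4; lra.
Qed.

Lemma floor_vertices : [/\ floorABC R 0, floorABC R (1, 0, 0) &
  floorABC R (0, 1, 0)].
Proof.
split; apply: sub_convex_hull; [left; left|left; right|right] => //.
Qed.

Lemma floor_min K : @convex_set R (space3 R) K ->
  K 0 -> K (1, 0, 0) -> K (0, 1, 0) -> floorABC R `<=` K.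
Proof.
move=> cK K0 K1 K2; apply: convex_hull_min => // w [[]|] -> //.
Qed.

Lemma tetrahedronE : tetrahedron R = simplex.
Proof.
apply/seteqP; split.
  apply: convex_hull_min; first exact: simplex_convex.
  by move=> w [[[]|]|] ->; split=> /=; lra.
move=> w [w1 w2 w3 w4].
have -> : w = w.1.1 *: (1, 0, 0) + w.1.2 *: (0, 1, 0) + (w.2 / 6) *: (0, 0, 6).
  by apply: space3_eq; rewrite !space3E/=; field.
apply: convex_combination3 => //; first exact: convex_hull_convex.
- by apply: sub_convex_hull; left; left; left.
- by apply: sub_convex_hull; left; left; right.
- by apply: sub_convex_hull; left; right.
- by apply: sub_convex_hull; right.
- by rewrite divr_ge0.
Qed.

(** Points of T off the three facets through A. For them the divisions in [slope], [coordsB] and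
    [coordsC] are meaningful, and the other points of T form a null set. *)
Definition generic x := [/\ 0 < x.1.1, 0 < x.1.2, 0 < x.2 & simplex x].

Lemma generic_slope x : generic x ->
  [/\ 0 < slope x, slope x <= 1 & x.2 = 6 * slope x * (1 - x.1.1 - x.1.2)].
Proof.
move=> [x1 x2 x3 [_ _ _ x4]].
have c0 : 0 < 1 - x.1.1 - x.1.2 by lra.
have c6 : 0 < 6 * (1 - x.1.1 - x.1.2) by rewrite mulr_gt0.
split; first by rewrite /slope divr_gt0.
- by rewrite /slope ler_pdivrMr// mul1r; lra.
- by rewrite /slope; field; rewrite gt_eqF.
Qed.

(* The inverses of the linear maps sending the vertices A, B, C, D to
   A, B, X, Y, respectively to A, X, C, Y. *)
Definition coordsB x w : space3 R :=
  (w.1.1 - x.1.1 * w.1.2 / x.1.2, w.1.2 / x.1.2,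
   (w.2 - x.2 * w.1.2 / x.1.2) / slope x).
Definition coordsC x w : space3 R :=
  (w.1.1 / x.1.1, w.1.2 - x.1.2 * w.1.1 / x.1.1,
   (w.2 - x.2 * w.1.1 / x.1.1) / slope x).

(** The inequalities belong, in this order, to the facets AXY, ABY, ABX and BXY; the last lies in
    the plane through B, C, X. *)
Lemma simplex_coordsB x w : generic x ->
  simplex (coordsB x w) <->
  [/\ x.1.1 * w.1.2 <= x.1.2 * w.1.1, 0 <= w.1.2, x.2 * w.1.2 <= x.1.2 * w.2 &
      w.2 <= 6 * slope x * (1 - w.1.1 - w.1.2)].
Proof.
move=> gx; have [r0 r1 sE] := generic_slope gx; case: gx => p0 q0 s0 _.
rewrite /coordsB; set r := slope x in r0 r1 sE *.
have q0' : x.1.2 != 0 by rewrite gt_eqF.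
have r0' : r != 0 by rewrite gt_eqF.
rewrite /simplex/=.
have -> : (0 <= w.1.1 - x.1.1 * w.1.2 / x.1.2) =
    (x.1.1 * w.1.2 <= x.1.2 * w.1.1).
  by rewrite subr_ge0 ler_pdivrMr// [w.1.1 * _]mulrC.
have -> : (0 <= w.1.2 / x.1.2) = (0 <= w.1.2) by rewrite pmulr_lge0// invr_gt0.
have -> : (0 <= (w.2 - x.2 * w.1.2 / x.1.2) / r) = (x.2 * w.1.2 <= x.1.2 * w.2).
  by rewrite pmulr_lge0 ?invr_gt0// subr_ge0 ler_pdivrMr// [w.2 * _]mulrC.
have -> : w.1.1 - x.1.1 * w.1.2 / x.1.2 + w.1.2 / x.1.2 +
  (w.2 - x.2 * w.1.2 / x.1.2) / r / 6 = w.1.1 + w.1.2 + w.2 / (6 * r).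
  by rewrite sE; field; rewrite q0' r0'.
have -> // : (w.1.1 + w.1.2 + w.2 / (6 * r) <= 1) =
  (w.2 <= 6 * r * (1 - w.1.1 - w.1.2)).
have c6 : 0 < 6 * r by rewrite mulr_gt0.
by rewrite -lerBrDl (ler_pdivrMr _ _ c6) [_ * (6 * r)]mulrC opprD addrA.
Qed.

Lemma simplex_coordsC x w : generic x ->
  simplex (coordsC x w) <->
  [/\ 0 <= w.1.1, x.1.2 * w.1.1 <= x.1.1 * w.1.2, x.2 * w.1.1 <= x.1.1 * w.2 &
      w.2 <= 6 * slope x * (1 - w.1.1 - w.1.2)].
Proof.
move=> gx; have [r0 r1 sE] := generic_slope gx; case: gx => p0 q0 s0 _.
rewrite /coordsC; set r := slope x in r0 r1 sE *.
have p0' : x.1.1 != 0 by rewrite gt_eqF.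
have r0' : r != 0 by rewrite gt_eqF.
rewrite /simplex/=.
have -> : (0 <= w.1.2 - x.1.2 * w.1.1 / x.1.1) =
    (x.1.2 * w.1.1 <= x.1.1 * w.1.2).
  by rewrite subr_ge0 ler_pdivrMr// [w.1.2 * _]mulrC.
have -> : (0 <= w.1.1 / x.1.1) = (0 <= w.1.1) by rewrite pmulr_lge0// invr_gt0.
have -> : (0 <= (w.2 - x.2 * w.1.1 / x.1.1) / r) = (x.2 * w.1.1 <= x.1.1 * w.2).
  by rewrite pmulr_lge0 ?invr_gt0// subr_ge0 ler_pdivrMr// [w.2 * _]mulrC.
have -> : w.1.1 / x.1.1 + (w.1.2 - x.1.2 * w.1.1 / x.1.1) +
  (w.2 - x.2 * w.1.1 / x.1.1) / r / 6 = w.1.1 + w.1.2 + w.2 / (6 * r).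
  by rewrite sE; field; rewrite p0' r0'.
have -> // : (w.1.1 + w.1.2 + w.2 / (6 * r) <= 1) =
  (w.2 <= 6 * r * (1 - w.1.1 - w.1.2)).
have c6 : 0 < 6 * r by rewrite mulr_gt0.
by rewrite -lerBrDl (ler_pdivrMr _ _ c6) [_ * (6 * r)]mulrC opprD addrA.
Qed.

(** As the slope is at most 1, Y lies on the segment AD, so ABXY is contained in ABCD. *)
Lemma coordsB_sub x w : generic x -> simplex (coordsB x w) -> simplex w.
Proof.
move=> gx /(simplex_coordsB _ gx)[w1 w2 w3 w4].
have [r0 r1 sE] := generic_slope gx; case: gx => p0 q0 s0 _.
have w30 : 0 <= w.2.
  by rewrite -(pmulr_rge0 _ q0) (le_trans _ w3)// mulr_ge0// ltW.
split => //.
- by rewrite -(pmulr_rge0 _ q0) (le_trans _ w1)// mulr_ge0// ltW.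
- have : w.2 <= 6 * (1 - w.1.1 - w.1.2).
    apply: (le_trans w4); rewrite -mulrA ler_pM2l// ler_piMl//.
    have c6 : 0 < 6 * slope x by rewrite mulr_gt0.
    rewrite -(pmulr_rge0 _ c6); exact: le_trans w30 w4.
  by lra.
Qed.

Lemma coordsC_sub x w : generic x -> simplex (coordsC x w) -> simplex w.
Proof.
move=> gx /(simplex_coordsC _ gx)[w1 w2 w3 w4].
have [r0 r1 sE] := generic_slope gx; case: gx => p0 q0 s0 _.
have w30 : 0 <= w.2.
  by rewrite -(pmulr_rge0 _ p0) (le_trans _ w3)// mulr_ge0// ltW.
split => //.
- by rewrite -(pmulr_rge0 _ p0) (le_trans _ w2)// mulr_ge0// ltW.
- have : w.2 <= 6 * (1 - w.1.1 - w.1.2).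
    apply: (le_trans w4); rewrite -mulrA ler_pM2l// ler_piMl//.
    have c6 : 0 < 6 * slope x by rewrite mulr_gt0.
    rewrite -(pmulr_rge0 _ c6); exact: le_trans w30 w4.
  by lra.
Qed.

Lemma near_affine_gt0 w (a b c d : R) :
  0 < a * w.1.1 + b * w.1.2 + c * w.2 + d ->
  \forall u \near w, 0 < a * u.1.1 + b * u.1.2 + c * u.2 + d.
Proof.
move=> w0.
have c11 : (fun u : space3 R => u.1.1) @ w --> w.1.1.
  by apply: cvg_comp; exact: cvg_fst.
have c12 : (fun u : space3 R => u.1.2) @ w --> w.1.2.
  by apply: cvg_comp; [exact: cvg_fst|exact: cvg_snd].
have c2 : (fun u : space3 R => u.2) @ w --> w.2 by exact: cvg_snd.
have H : (fun u : space3 R => a * u.1.1 + b * u.1.2 + c * u.2 + d) @ w -->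
    a * w.1.1 + b * w.1.2 + c * w.2 + d.
  apply: cvgD; last exact: cvg_cst.
  apply: cvgD; first apply: cvgD; apply: cvgM => //; exact: cvg_cst.
exact: (H _ (lt_nbhsr w0)).
Qed.

(* The points below the plane through B, C, X and in neither of the
   two tetrahedra ABXY, AXCY lie in the open tetrahedron ABCX. *)
Lemma interior_tetrahedron K x w : @convex_set R (space3 R) K ->
  floorABC R `<=` K -> K x -> generic x -> simplex w -> 0 < w.2 ->
  w.2 < 6 * slope x * (1 - w.1.1 - w.1.2) ->
  ~ simplex (coordsB x w) -> ~ simplex (coordsC x w) -> interior K w.
Proof.
move=> cK fK Kx gx [w1 w2 _ w4] w3 wr.
move=> /(simplex_coordsB _ gx) nB /(simplex_coordsC _ gx) nC.
have [r0 r1 sE] := generic_slope gx; case: (gx) => p0 q0 s0 _.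
have [f0 fB fC] := floor_vertices.
(* Say [w] is on the B side of the plane AXY. Not being in ABXY, it is strictly below the plane ABX,
   and combining both facts puts it strictly below AXC. The other side is symmetric. *)
have ineq : x.1.1 * w.2 < x.2 * w.1.1 /\ x.1.2 * w.2 < x.2 * w.1.2.
  have [h|h] := leP (x.1.1 * w.1.2) (x.1.2 * w.1.1).
    have h2 : x.1.2 * w.2 < x.2 * w.1.2.
      by rewrite ltNge; apply/negP => h2; apply: nB; split=> //; exact: ltW.
    split=> //; rewrite -(ltr_pM2l q0).
    have := ler_wpM2l (ltW s0) h; have := @ltr_pM2l _ _ p0 (x.1.2 * w.2) (x.2 * w.1.2).
    by rewrite h2 => h3 h4; move: h3; lra.
  have h2 : x.1.1 * w.2 < x.2 * w.1.1.
    by rewrite ltNge; apply/negP => h2; apply: nC; split=> //; exact: ltW.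
  split=> //; rewrite -(ltr_pM2l p0).
  have := ler_wpM2l (ltW s0) (ltW h).
  have := @ltr_pM2l _ _ q0 (x.1.1 * w.2) (x.2 * w.1.1).
  by rewrite h2 => h3 h4; move: h3; lra.
case: ineq => h1 h2.
have s0' : x.2 != 0 by rewrite gt_eqF.
have n1 : \forall u \near w, 0 < u.2.
  have := @near_affine_gt0 w 0 0 1 0.
  by rewrite !mul0r !add0r mul1r addr0 => /(_ w3); apply: filterS => u;
     rewrite !mul0r !add0r mul1r addr0.
have n2 : \forall u \near w, 0 < x.2 * u.1.1 + 0 * u.1.2 + - x.1.1 * u.2 + 0.
  by apply: near_affine_gt0; lra.
have n3 : \forall u \near w, 0 < 0 * u.1.1 + x.2 * u.1.2 + - x.1.2 * u.2 + 0.
  by apply: near_affine_gt0; lra.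
have n4 : \forall u \near w, 0 < - (6 * slope x) * u.1.1 +
    - (6 * slope x) * u.1.2 + -1 * u.2 + 6 * slope x.
  by apply: near_affine_gt0; lra.
rewrite /interior; apply: filterS (filterI (filterI n1 n2) (filterI n3 n4)).
move=> u [[u1 u2] [u3 u4]].
(* Barycentric coordinates in ABCX: [u1] to [u4] express the positivity of the weights of X, B, C
   and A. *)
have -> : u = (u.1.1 - x.1.1 * (u.2 / x.2)) *: (1, 0, 0) +
    (u.1.2 - x.1.2 * (u.2 / x.2)) *: (0, 1, 0) + (u.2 / x.2) *: x.
  by apply: space3_eq; rewrite !space3E/=; field.
apply: convex_combination3 => //; [exact: fK|exact: fK|exact: fK|..].
- rewrite mulrA subr_ge0 ler_pdivrMr//; move: u2; lra.
- rewrite mulrA subr_ge0 ler_pdivrMr//; move: u3; lra.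
- by rewrite divr_ge0// ltW.
rewrite (_ : _ + _ = u.1.1 + u.1.2 + u.2 / x.2 * (1 - x.1.1 - x.1.2)); last by ring.
rewrite {1}sE (_ : u.2 / _ * _ = u.2 / (6 * slope x)); last first.
  have c0 : 1 - x.1.1 - x.1.2 != 0.
    by apply/eqP => c0; move: s0; rewrite sE c0 mulr0 ltxx.
  by field; rewrite (gt_eqF r0) c0.
have c6 : 0 < 6 * slope x by rewrite mulr_gt0.
by rewrite -lerBrDl (ler_pdivrMr _ _ c6); move: u4; lra.
Qed.

(** As [f] is affine and undoes [g], it maps the hull of [S'] and the floor into the hull of [S]
    once it does so with [S'] and the three floor vertices. Continuity of [g] then brings
    neighbourhoods of [g w] back to [w]. *)
Lemma interior_pullback (f g : space3 R -> space3 R) S S' w :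
  (forall (t : R) u v, f (t *: u + (1 - t) *: v) = t *: f u + (1 - t) *: f v) ->
  cancel g f -> continuous g -> S' `<=` g @` S ->
  convex_hull S (f 0) -> convex_hull S (f (1, 0, 0)) ->
  convex_hull S (f (0, 1, 0)) ->
  interior (convex_hull (S' `|` floorABC R)) (g w) -> interior (convex_hull S) w.
Proof.
move=> fA fK cg SS' f0 f1 f2 gw.
have sub : convex_hull (S' `|` floorABC R) `<=` f @^-1` convex_hull S.
  have cf : @convex_set R (space3 R) (f @^-1` convex_hull S).
    apply/convex_setE => u v t t01 /= Ku Kv; rewrite fA.
    by have /convex_setE := @convex_hull_convex R (space3 R) S; apply.
  apply: convex_hull_min => // u [/SS' [v Sv <-]|].
    by rewrite /= fK; exact: sub_convex_hull.
  exact: floor_min.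
have H : nbhs w (g @^-1` convex_hull (S' `|` floorABC R)) by exact: cg.
rewrite /interior; apply: filterS H => u /sub.
by rewrite /= fK.
Qed.

Lemma continuous_coord1 : continuous (fun w : space3 R => w.1.1).
Proof. by move=> w; apply: cvg_comp; exact: cvg_fst. Qed.

Lemma continuous_coord2 : continuous (fun w : space3 R => w.1.2).
Proof. by move=> w; apply: cvg_comp; [exact: cvg_fst|exact: cvg_snd]. Qed.

Lemma continuous_coord3 : continuous (fun w : space3 R => w.2).
Proof. by move=> w; exact: cvg_snd. Qed.

Lemma continuous_pair (U V W : topologicalType) (f : U -> V) (g : U -> W) :
  continuous f -> continuous g -> continuous (fun a => (f a, g a)).
Proof. by move=> cf cg a; apply: (cvg_pair (cf a) (cg a)). Qed.

Lemma continuous_coordsB x : continuous (coordsB x).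
Proof.
have c1 := continuous_coord1; have c2 := continuous_coord2; have c3 := continuous_coord3.
apply: continuous_pair; first apply: continuous_pair; move=> w.
- apply: cvgB; first exact: c1.
  apply: cvgM; last exact: cvg_cst.
  by apply: cvgM; [exact: cvg_cst|exact: c2].
- by apply: cvgM; [exact: c2|exact: cvg_cst].
- apply: cvgM; last exact: cvg_cst.
  apply: cvgB; first exact: c3.
  apply: cvgM; last exact: cvg_cst.
  by apply: cvgM; [exact: cvg_cst|exact: c2].
Qed.

Lemma continuous_coordsC x : continuous (coordsC x).
Proof.
have c1 := continuous_coord1; have c2 := continuous_coord2; have c3 := continuous_coord3.
apply: continuous_pair; first apply: continuous_pair; move=> w.
- by apply: cvgM; [exact: c1|exact: cvg_cst].
- apply: cvgB; first exact: c2.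
  apply: cvgM; last exact: cvg_cst.
  by apply: cvgM; [exact: cvg_cst|exact: c1].
- apply: cvgM; last exact: cvg_cst.
  apply: cvgB; first exact: c3.
  apply: cvgM; last exact: cvg_cst.
  by apply: cvgM; [exact: cvg_cst|exact: c1].
Qed.

(** The pullback is along the linear map taking A, B, C, D to A, B, X, Y. It turns the floor into
    ABX, whose vertices lie in [S]. Read contrapositively, convex position above ABC is inherited
    inside ABXY with floor ABX. *)
Lemma interior_coordsB S S' x w : generic x -> S x -> floorABC R `<=` S ->
  S' `<=` coordsB x @` S ->
  interior (convex_hull (S' `|` floorABC R)) (coordsB x w) ->
  interior (convex_hull S) w.
Proof.
move=> gx Sx fS S'S; have [r0 _ _] := generic_slope gx; case: gx => p0 q0 s0 _.
have [f0 fB fC] := floor_vertices.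
apply: (@interior_pullback (fun w => (w.1.1 + x.1.1 * w.1.2, x.1.2 * w.1.2,
   x.2 * w.1.2 + slope x * w.2)) (coordsB x)) => //.
- by move=> t u v; apply: space3_eq; rewrite !space3E/=; ring.
- move=> u; apply: space3_eq; rewrite /coordsB/=; field; rewrite ?(gt_eqF q0)//.
  by rewrite (gt_eqF r0).
- exact: continuous_coordsB.
- by rewrite /= !mulr0 !addr0; apply: sub_convex_hull; exact: fS.
- by rewrite /= !mulr0 !addr0; apply: sub_convex_hull; exact: fS.
- rewrite /= !mulr1 mulr0 add0r addr0.
  have -> : (x.1.1, x.1.2, x.2) = x by apply: space3_eq.
  exact: sub_convex_hull.
Qed.

Lemma interior_coordsC S S' x w : generic x -> S x -> floorABC R `<=` S ->
  S' `<=` coordsC x @` S ->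
  interior (convex_hull (S' `|` floorABC R)) (coordsC x w) ->
  interior (convex_hull S) w.
Proof.
move=> gx Sx fS S'S; have [r0 _ _] := generic_slope gx; case: gx => p0 q0 s0 _.
have [f0 fB fC] := floor_vertices.
apply: (@interior_pullback (fun w => (x.1.1 * w.1.1, w.1.2 + x.1.2 * w.1.1,
   x.2 * w.1.1 + slope x * w.2)) (coordsC x)) => //.
- by move=> t u v; apply: space3_eq; rewrite !space3E/=; ring.
- move=> u; apply: space3_eq; rewrite /coordsC/=; field; rewrite ?(gt_eqF p0)//.
  by rewrite (gt_eqF r0).
- exact: continuous_coordsC.
- by rewrite /= !mulr0 !addr0; apply: sub_convex_hull; exact: fS.
- rewrite /= !mulr1 mulr0 add0r addr0.
  have -> : (x.1.1, x.1.2, x.2) = x by apply: space3_eq.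
  exact: sub_convex_hull.
- by rewrite /= !mulr0 !addr0; apply: sub_convex_hull; exact: fS.
Qed.

End simplex_geometry.

(** * Families of independent uniform points *)

Section finite_subadditivity.
Context d (T : measurableType d) (R : realType) (mu : {measure set T -> \bar R}).

Lemma measure_bigsetU_le (I : Type) (r : seq I) (P : pred I) (F : I -> set T) :
  (forall i, P i -> measurable (F i)) ->
  (mu (\big[setU/set0]_(i <- r | P i) F i) <= \sum_(i <- r | P i) mu (F i))%E.
Proof.
move=> mF; elim: r => [|i r IH]; first by rewrite !big_nil measure0.
rewrite !big_cons; case: ifPn => // Pi.
have mU : measurable (\big[setU/set0]_(j <- r | P j) F j).
  exact: bigsetU_measurable.
apply: (@le_trans _ _ (mu (F i) + mu (\big[setU/set0]_(j <- r | P j) F j))%E).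
  by apply: measureU2 => //; exact: mF.
exact: leeD2l.
Qed.

Lemma measure_cover_le (I : finType) (P : pred I) (F : I -> set T) A :
  measurable A -> (forall i, P i -> measurable (F i)) ->
  (forall t, A t -> exists2 i, P i & F i t) ->
  (mu A <= \sum_(i | P i) mu (F i))%E.
Proof.
move=> mA mF AF; apply: (le_trans _ (measure_bigsetU_le _ mF)).
apply: le_measure; rewrite ?inE//; first exact: bigsetU_measurable.
by move=> t /AF[i Pi Fi]; rewrite -bigcup_seq_cond; exists i => //=; rewrite mem_index_enum.
Qed.

End finite_subadditivity.

Section families.
Context {R : realType} {I : finType}.
Implicit Types (J K : {set I}) (A : I -> set (space3 R)) (v : I -> space3 R).
Notation lam := (@lebesgue_measure R).

(** Families are functions on all of [I], and [J] only tells which coordinates the generated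
    sigma-algebra sees, so passing to a subfamily does not change the type. *)
Definition rects J : set (set (I -> space3 R)) :=
  [set B | exists2 A, (forall j, measurable (A j)) &
     B = [set v | forall j, j \in J -> A j (v j)]].

Notation family J := (g_sigma_algebraType (rects J)).

Lemma rects_setI J : setI_closed (rects J).
Proof.
move=> _ _ [A mA ->] [B mB ->]; exists (fun j => A j `&` B j).
  by move=> j; exact: measurableI.
by apply/seteqP; split=> v /= => [[Av Bv] j jJ|ABv]; [split; auto|
  split=> j /ABv[]].
Qed.

Lemma rects_setT J : rects J setT.
Proof. by exists (fun=> setT) => //; apply/seteqP; split. Qed.

Lemma measurable_family_coord J j : j \in J ->
  measurable_fun setT (fun v : family J => (v : I -> space3 R) j).
Proof.
move=> jJ _ A mA; rewrite setTI; apply: sub_sigma_algebra.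
exists (fun k => if k == j then A else setT).
  by move=> k; case: ifP.
apply/seteqP; split=> v /= => [Av k kJ|/(_ j jJ)]; last by rewrite eqxx.
by case: eqP => // ->.
Qed.

Section mapping.
Context d (Omega : measurableType d).

Lemma measurable_family J (V : I -> Omega -> space3 R) :
  (forall j, j \in J -> measurable_fun setT (V j)) ->
  measurable_fun setT (fun omega => (fun j => V j omega) : family J).
Proof.
move=> mV; apply: (@measurability _ _ _ (family J) setT _ (rects J)) => //.
move=> _ [_ [A mA ->] <-]; rewrite setTI.
rewrite (_ : _ @^-1` _ =
    \bigcap_(j in [set` J]) (V j @^-1` A j)); last by apply/seteqP; split.
apply: fin_bigcap_measurable => // j jJ.
by rewrite -[X in measurable X]setTI; apply: mV.
Qed.

Variable P : {measure set Omega -> \bar R}.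

(** Independence and uniformity on T in one product formula, without normalising factor because T
    has volume 1. It speaks of rectangles only; [same_law] reaches all events. *)
Definition rect_law (V : I -> Omega -> space3 R) J :=
  forall A, (forall j, measurable (A j)) ->
    P [set omega | forall j, j \in J -> A j (V j omega)] =
    (\prod_(j in J) volume (A j `&` simplex))%E.

Lemma rect_law_sub V J K : K \subset J -> rect_law V J -> rect_law V K.
Proof.
move=> /fintype.subsetP KJ VJ A mA.
rewrite (_ : [set _ | _] = [set omega | forall j, j \in J ->
    (if j \in K then A j else setT) (V j omega)]).
  rewrite (VJ (fun j => if j \in K then A j else setT)); last by move=> j; case: ifP.
  rewrite (bigID (fun j => j \in K))/= [X in (_ * X)%E]big1 ?mule1.
    apply: eq_big => [j|j /andP[_ ->//]].
    by case: (boolP (j \in K)) => [/KJ->|]; rewrite ?andbF.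
  by move=> j /andP[_ /negbTE->]; rewrite setTI volume_simplex.
apply/seteqP; split=> omega /= H j; last by move=> jK; have := H _ (KJ _ jK); rewrite jK.
by case: ifP => // jK _; exact: H.
Qed.

Lemma rect_law_setT V J : rect_law V J -> P setT = 1%E.
Proof.
move=> /(_ (fun=> setT) (fun=> measurableT)) H.
rewrite (_ : setT = [set omega | forall j, j \in J -> setT (V j omega)]) ?H.
  by apply: big1 => j _; rewrite setTI volume_simplex.
by apply/seteqP; split.
Qed.

Lemma rect_law1 V J j (A : set (space3 R)) : j \in J -> rect_law V J -> measurable A ->
  P [set omega | A (V j omega)] = volume (A `&` simplex).
Proof.
move=> jJ VJ mA; have {}VJ : rect_law V [set j].
  by apply: rect_law_sub VJ; rewrite finset.sub1set.
have := VJ (fun=> A) (fun=> mA); rewrite big_set1 => <-.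
by congr (P _); apply/seteqP; split=> omega /= H; [move=> k; rewrite inE => /eqP->|
  apply: H; rewrite inE].
Qed.

End mapping.

(** Rectangles are stable under intersection and generate the sigma-algebra, so finite measures
    agreeing on them coincide. Thus the sample space can be replaced without changing
    probabilities. *)
Lemma same_law d1 d2 (O1 : measurableType d1) (O2 : measurableType d2)
    (P1 : {measure set O1 -> \bar R}) (P2 : {measure set O2 -> \bar R})
    (V1 : I -> O1 -> space3 R) (V2 : I -> O2 -> space3 R) J (E : set (family J)) :
  (forall j, j \in J -> measurable_fun setT (V1 j)) ->
  (forall j, j \in J -> measurable_fun setT (V2 j)) ->
  rect_law P1 V1 J -> rect_law P2 V2 J -> measurable E ->
  P1 [set omega | E (fun j => V1 j omega)] = P2 [set omega | E (fun j => V2 j omega)].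
Proof.
move=> mV1 mV2 L1 L2 mE.
pose f1 omega : family J := fun j => V1 j omega.
pose f2 omega : family J := fun j => V2 j omega.
have mf1 : measurable_fun setT f1 by exact: measurable_family.
have mf2 : measurable_fun setT f2 by exact: measurable_family.
have T1 := rect_law_setT L1.
rewrite -[LHS]/(pushforward P1 f1 E) -[RHS]/(pushforward P2 f2 E).
apply: (@measure_unique _ R (family J) (rects J) (fun=> setT) _ _ _ _
  (pushforward P1 f1) (pushforward P2 f2)) => //.
- exact: rects_setI.
- by move=> _; exact: rects_setT.
- by rewrite bigcup_const//; exists 0%N.
- by move=> _ [A mA ->]; exact: (etrans (L1 A mA) (esym (L2 A mA))).
- by move=> _; have := ltry (1 : R); rewrite -[1%:E]T1; apply.
Qed.

Section decoupling.
Context d (Omega : measurableType d) (P : probability Omega R).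
Context (V : I -> Omega -> space3 R) (J : {set I}).
Hypothesis mV : forall j, j \in J -> measurable_fun setT (V j).
Hypothesis VJ : rect_law P V J.

(** Coordinates in [K] are read in one copy of the sample space, the others in a second one. The
    joint law is unchanged, so Fubini on the product replaces conditioning on the points of [K]. *)
Definition merge K (omega : Omega * Omega) : I -> space3 R :=
  fun j => if j \in K then V j omega.1 else V j omega.2.

Lemma measurable_merge K j : j \in J ->
  measurable_fun setT (fun omega => merge K omega j).
Proof.
move=> jJ; rewrite /merge; case: (j \in K).
  exact: (measurableT_comp (mV jJ) measurable_fst).
exact: (measurableT_comp (mV jJ) measurable_snd).
Qed.

Lemma rect_law_merge K :
  rect_law (P \x P)%E (fun j omega => merge K omega j) J.
Proof.
move=> A mA.
pose A1 j := if j \in K then A j else setT.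
pose A2 j := if j \in K then setT else A j.
rewrite (_ : [set _ | _] =
    [set omega | forall j, j \in J -> A1 j (V j omega)] `*`
    [set omega | forall j, j \in J -> A2 j (V j omega)]).
  have mA1 j : measurable (A1 j) by rewrite /A1; case: ifP.
  have mA2 j : measurable (A2 j) by rewrite /A2; case: ifP.
  have mr (B : I -> set (space3 R)) : (forall j, measurable (B j)) ->
      measurable [set omega | forall j, j \in J -> B j (V j omega)].
    move=> mB; rewrite (_ : [set _ | _] = \bigcap_(j in [set` J]) (V j @^-1` B j)).
      apply: fin_bigcap_measurable => // j jJ.
      by rewrite -[X in measurable X]setTI; apply: mV.
    by apply/seteqP; split.
  apply: (etrans (product_measure1E _ _ (mr _ mA1) (mr _ mA2))).
  rewrite VJ// VJ// -big_split/=; apply: eq_bigr => j _.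
  by rewrite /A1 /A2; case: ifP => _; rewrite setTI volume_simplex ?mule1 ?mul1e.
rewrite /merge /A1 /A2; apply/seteqP; split=> [[w1 w2]|[w1 w2]].
  by move=> H; split=> j /H; case: ifP.
by move=> [H1 H2] j jJ; have := H1 j jJ; have := H2 j jJ; case: ifP.
Qed.

Lemma decouple K (E : set (family J)) : measurable E ->
  P [set omega | E (fun j => V j omega)] = (P \x P)%E [set omega | E (merge K omega)].
Proof.
move=> mE; apply: same_law => //; last exact: rect_law_merge.
exact: measurable_merge.
Qed.

(** On two copies of the sample space the conjunction becomes a rectangle, since each event looks at
    its own block only. *)
Lemma independent_blocks K (E1 E2 : set (I -> space3 R)) :
  (forall v v', (forall j, j \in K -> v j = v' j) -> E1 v -> E1 v') ->
  (forall v v', (forall j, j \notin K -> v j = v' j) -> E2 v -> E2 v') ->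
  measurable (E1 : set (family J)) -> measurable (E2 : set (family J)) ->
  P [set omega | E1 (fun j => V j omega) /\ E2 (fun j => V j omega)] =
  (P [set omega | E1 (fun j => V j omega)] *
   P [set omega | E2 (fun j => V j omega)])%E.
Proof.
move=> e1 e2 m1 m2.
rewrite (@decouple K ((E1 : set (family J)) `&` E2)); last exact: measurableI.
rewrite (_ : [set _ | _] = [set omega | E1 (fun j => V j omega)] `*`
    [set omega | E2 (fun j => V j omega)]).
  have mf := measurable_family mV.
  by apply: product_measure1E; rewrite -[X in measurable X]setTI; exact: mf.
by apply/seteqP; split=> [[w1 w2] [h1 h2]|[w1 w2] [h1 h2]]; split;
  [apply: e1 h1|apply: e2 h2|apply: e1 h1|apply: e2 h2] => j; rewrite /merge/=;
  do ?[move=> ->|move=> /negbTE->].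
Qed.

End decoupling.

End families.

(** * Convex position and its passage to a sub-tetrahedron *)

Section good_position.
Context {R : realType} {I : finType}.
Implicit Types (J K S : {set I}) (v : I -> space3 R) (x w : space3 R).
Notation lam := (@lebesgue_measure R).

(** Convex position through interiors alone: the points belong to the hull, so lying on its boundary
    just means not being interior. *)
Definition good K v := forall j, j \in K ->
  ~ interior (convex_hull ([set v k | k in [set` K]] `|` floorABC R)) (v j).

Lemma good_ext K v v' : (forall j, j \in K -> v j = v' j) -> good K v -> good K v'.
Proof.
move=> vv' gv j jK; rewrite -vv'//.
suff <- : [set v k | k in [set` K]] = [set v' k | k in [set` K]] by exact: gv.
by apply/seteqP; split=> _ [k /= kK <-]; exists k => //; rewrite vv'.
Qed.

(** Measurability of interiors is established for hulls of finitely many points; the three vertices,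
    as extra indices, stand in for the infinite floor. *)
Lemma hull_floor_image K v :
  convex_hull ([set v k | k in [set` K]] `|` floorABC R) =
  convex_hull [set (match t with
                    | inl k => v k
                    | inr None => 0
                    | inr (Some true) => (1, 0, 0)
                    | inr (Some false) => (0, 1, 0)
                    end) |
    t in [set` [set t : I + option bool | if t is inl k then k \in K else true]%SET]].
Proof.
have [f0 fB fC] := @floor_vertices R.
apply/seteqP; split; apply: convex_hull_min; try exact: convex_hull_convex.
  move=> w [[k /= kK <-]|].
    by apply: sub_convex_hull; exists (inl k) => //=; rewrite inE.
  apply: floor_min; first exact: convex_hull_convex.
  - by apply: sub_convex_hull; exists (inr None) => //=; rewrite inE.
  - by apply: sub_convex_hull; exists (inr (Some true)) => //=; rewrite inE.
  - by apply: sub_convex_hull; exists (inr (Some false)) => //=; rewrite inE.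
move=> _ [t /= tL <-]; apply: sub_convex_hull.
by case: t tL => [k|[[]|]]; rewrite inE => kK; [left; exists k|right..].
Qed.

Section measurability.
Context d (Z : measurableType d).

Lemma measurable_good K (V : I -> Z -> space3 R) :
  (forall j, j \in K -> measurable_fun setT (V j)) ->
  measurable [set z | good K (fun j => V j z)].
Proof.
move=> mV; rewrite (_ : [set z | _] = \bigcap_(j in [set` K])
  ~` [set z | interior (convex_hull ([set V k z | k in [set` K]] `|` floorABC R))
      (V j z)]); last by apply/seteqP; split.
apply: fin_bigcap_measurable => // j jK; apply: measurableC.
pose x (t : I + option bool) : Z -> space3 R := match t with
  | inl k => V k
  | inr None => fun=> 0
  | inr (Some true) => fun=> (1, 0, 0)
  | inr (Some false) => fun=> (0, 1, 0)
  end.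
pose L := [set t : I + option bool | if t is inl k then k \in K else true]%SET.
rewrite (_ : [set z | _] =
    [set z | interior (convex_hull [set x t z | t in [set` L]]) (V j z)]).
  apply: (@measurable_interior_hull R _ _ Z L x (V j)); last exact: mV.
  by move=> [k|[[]|]]; rewrite inE => kK; [exact: mV|exact: measurable_cst..].
apply/funext => z /=; rewrite hull_floor_image.
apply: (congr1 (fun A : set (space3 R) => interior (convex_hull A) (V j z))).
by apply/seteqP; split=> _ [t tL <-]; (exists t; first exact: tL);
  case: t tL => [k|[[]|]].
Qed.

(** Meant for [g = coordsB x] or [coordsC x]: in these coordinates the sub-tetrahedron becomes T and
    its floor ABX or AXC becomes ABC. *)
Definition piece (g : space3 R -> space3 R) K : set (I -> space3 R) :=
  [set v | (forall j, j \in K -> simplex (g (v j))) /\ good K (g \o v)].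

Lemma piece_ext g K v v' : (forall j, j \in K -> v j = v' j) ->
  piece g K v -> piece g K v'.
Proof.
move=> vv' [h1 h2]; split; first by move=> j jK; rewrite -vv'//; exact: h1.
by apply: good_ext h2 => j jK /=; rewrite vv'.
Qed.

Lemma measurable_piece g K (V : I -> Z -> space3 R) : measurable_fun setT g ->
  (forall j, j \in K -> measurable_fun setT (V j)) ->
  measurable [set z | piece g K (fun j => V j z)].
Proof.
move=> mg mV.
have mgV j : j \in K -> measurable_fun setT (g \o V j).
  by move=> jK; apply: measurableT_comp => //; exact: mV.
rewrite (_ : [set z | _] = (\bigcap_(j in [set` K]) ((g \o V j) @^-1` simplex)) `&`
    [set z | good K (fun j => (g \o V j) z)]); last by apply/seteqP; split.
apply: measurableI; last exact: measurable_good.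
apply: fin_bigcap_measurable => // j jK.
by rewrite -[X in measurable X]setTI; apply: mgV => //; exact: measurable_simplex.
Qed.

End measurability.

Lemma measurable_coordsB x : measurable_fun setT (coordsB x).
Proof.
have [m1 m2 m3] := And3 (@measurable_coord1 R) (@measurable_coord2 R) (@measurable_coord3 R).
apply: measurable_fun_pair; first apply: measurable_fun_pair.
- apply: measurable_funB => //; apply: measurable_funM => //.
  exact: measurable_funM.
- exact: measurable_funM.
- apply: measurable_funM => //; apply: measurable_funB => //.
  by apply: measurable_funM => //; exact: measurable_funM.
Qed.

Lemma measurable_coordsC x : measurable_fun setT (coordsC x).
Proof.
have [m1 m2 m3] := And3 (@measurable_coord1 R) (@measurable_coord2 R) (@measurable_coord3 R).
apply: measurable_fun_pair; first apply: measurable_fun_pair.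
- exact: measurable_funM.
- apply: measurable_funB => //; apply: measurable_funM => //.
  exact: measurable_funM.
- apply: measurable_funM => //; apply: measurable_funB => //.
  by apply: measurable_funM => //; exact: measurable_funM.
Qed.

Lemma measurable_generic : measurable [set x : space3 R | generic x].
Proof.
have [m1 m2 m3] := And3 (@measurable_coord1 R) (@measurable_coord2 R) (@measurable_coord3 R).
rewrite (_ : [set x | _] = [set x | 0 < x.1.1] `&` [set x | 0 < x.1.2] `&`
   [set x | 0 < x.2] `&` simplex).
  apply: measurableI; last exact: measurable_simplex.
  by apply: measurableI; first apply: measurableI; exact: measurable_lt_set.
by apply/seteqP; split=> w /= => [[]|[[[]]]].
Qed.

Lemma volume_nongeneric : volume (~` [set x : space3 R | generic x] `&` simplex) = 0%E.
Proof.
have [m1 m2 m3] := And3 (@measurable_coord1 R) (@measurable_coord2 R) (@measurable_coord3 R).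
pose Z1 := [set w : space3 R | w.1.1 = 0]; pose Z2 := [set w : space3 R | w.1.2 = 0].
pose Z3 := [set w : space3 R | w.2 = 0].
have mZ (f : space3 R -> R) : measurable_fun setT f -> measurable [set w | f w = 0].
  by move=> mf; rewrite -[X in measurable X]setTI; exact: (mf measurableT [set 0]).
have mZ1 : measurable Z1 by exact: mZ.
have mZ2 : measurable Z2 by exact: mZ.
have mZ3 : measurable Z3 by exact: mZ.
have mZ12 : measurable (Z1 `|` Z2) by exact: measurableU.
have mZ123 : measurable ((Z1 `|` Z2) `|` Z3) by exact: measurableU.
have mS : measurable (~` [set x : space3 R | generic x] `&` simplex).
  by apply: measurableI; [apply: measurableC; exact: measurable_generic|exact: measurable_simplex].
apply/eqP; rewrite -measure_le0.
apply: (@le_trans _ _ (volume ((Z1 `|` Z2) `|` Z3))).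
  apply: le_measure; rewrite ?inE// => w /= [ng sw].
  case: (sw) => w1 w2 w3 _; rewrite /Z1 /Z2 /Z3/=.
  have [->|w10] := eqVneq w.1.1 0; first by left; left.
  have [->|w20] := eqVneq w.1.2 0; first by left; right.
  have [->|w30] := eqVneq w.2 0; first by right.
  by case: ng; split=> //; rewrite lt_neqAle eq_sym ?w10 ?w20 ?w30.
apply: le_trans (measureU2 _ mZ12 mZ3) _.
rewrite [X in (_ + X)%E](volume_graph (fun=> 0)) adde0.
apply: le_trans (measureU2 _ mZ1 mZ2) _.
by rewrite [X in (_ + X)%E]volume_side2 adde0 [leLHS]volume_side1.
Qed.

Section bound_step.
Context d (Omega : measurableType d).
Implicit Types (P : probability Omega R) (V : I -> Omega -> space3 R).

Lemma prode_scale K (k : R) (f : I -> \bar R) :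
  (\prod_(j in K) (k%:E * f j) = (k ^+ #|K|)%:E * \prod_(j in K) f j)%E.
Proof.
rewrite big_split/=; congr (_ * _)%E.
by rewrite prodEFin; congr EFin; rewrite prodr_const.
Qed.

(** Conditioned on all points of [K] falling in the piece, an event of probability [k ^+ #|K|],
    their images under [g] are again independent and uniform on T. The bound is applied to this
    conditional law, which is why it is assumed for every [Q] and every family. *)
Lemma probability_piece P V K (g : space3 R -> space3 R) (k : R) (c : \bar R) :
  (forall j, j \in K -> measurable_fun setT (V j)) -> rect_law P V K ->
  measurable_fun setT g -> 0 < k ->
  (forall A, measurable A -> volume [set w | A (g w)] = (k%:E * volume A)%E) ->
  (forall w, simplex (g w) -> simplex w) ->
  (forall (Q : probability Omega R) V', (forall j, j \in K -> measurable_fun setT (V' j)) ->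
     rect_law Q V' K -> (Q [set omega | good K (fun j => V' j omega)] <= c)%E) ->
  (P [set omega | piece g K (fun j => V j omega)] <= (k ^+ #|K|)%:E * c)%E.
Proof.
move=> mV VK mg k0 gk gs bound.
have kK0 : 0 < k ^+ #|K| by rewrite exprn_gt0.
pose gV j := g \o V j.
have mgV j : j \in K -> measurable_fun setT (gV j).
  by move=> jK; apply: measurableT_comp => //; exact: mV.
pose C := [set omega | forall j, j \in K -> simplex (gV j omega)].
have volg (A : set (space3 R)) : measurable A ->
    volume ([set w | A (g w) /\ simplex (g w)] `&` simplex) =
    (k%:E * volume (A `&` simplex))%E.
  move=> mA; rewrite -gk; last by apply: measurableI => //; exact: measurable_simplex.
  congr (volume _); apply/seteqP; split=> w /= => [[]//|[Aw sw]].
  by split=> //; exact: gs.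
have PC (A : I -> set (space3 R)) : (forall j, measurable (A j)) ->
    P ([set omega | forall j, j \in K -> A j (gV j omega)] `&` C) =
    ((k ^+ #|K|)%:E * \prod_(j in K) volume (A j `&` simplex))%E.
  move=> mA; rewrite -prode_scale.
  under [RHS]eq_bigr do rewrite -volg//.
  rewrite -(VK (fun j => [set w | A j (g w) /\ simplex (g w)])).
    congr (P _); apply/seteqP; split=> omega /= => [[h1 h2] j jK|h].
      by split; [exact: h1|exact: h2].
    by split=> j /h[].
  move=> j; rewrite (_ : [set w | _] = setT `&` g @^-1` (A j `&` simplex)).
    by apply: mg => //; apply: measurableI => //; exact: measurable_simplex.
  by rewrite setTI.
have mC : measurable C.
  rewrite (_ : C = \bigcap_(j in [set` K]) (gV j @^-1` simplex)).
    apply: fin_bigcap_measurable => // j jK.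
    by rewrite -[X in measurable X]setTI; apply: mgV => //; exact: measurable_simplex.
  by apply/seteqP; split.
have PCE : P C = (k ^+ #|K|)%:E.
  have := PC (fun=> setT) (fun=> measurableT).
  rewrite (_ : _ `&` C = C); last by apply/seteqP; split=> omega // [].
  move=> ->; rewrite big1 ?mule1// => j _.
  by rewrite setTI volume_simplex.
(* The conditional probability given [C]. The final [P] is the fallback of [mnormalize] for zero or
   infinite mass, a case excluded by [PCE] and [kK0]. *)
pose Q : probability Omega R := mnormalize (mrestr P mC) P.
have QE A : Q A = (P (A `&` C) * ((k ^+ #|K|)^-1)%:E)%E.
  rewrite /Q/= /mnormalize/= /mrestr/= setTI PCE.
  by rewrite eqe gt_eqF//=.
have gVK : rect_law Q gV K.
  move=> A mA; apply: (etrans (QE _)); rewrite PC// muleAC -EFinM divff ?mul1e// gt_eqF//.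
have : (P ([set omega | good K (fun j => gV j omega)] `&` C) *
    ((k ^+ #|K|)^-1)%:E <= c)%E.
  by apply: le_trans (bound Q gV mgV gVK); rewrite -[leLHS]QE.
rewrite lee_pdivrMr// [leRHS]muleC; apply: le_trans.
rewrite le_eqVlt; apply/orP; left; apply/eqP; congr (P _).
by apply/seteqP; split=> omega [h1 h2]; split.
Qed.

End bound_step.
End good_position.

(** * The recursion *)

Section recursion.
Context {R : realType} {I : finType} (u : nat -> R).
Hypothesis u_ge0 : forall n, 0 <= u n.
Implicit Types (J K S : {set I}) (v : I -> space3 R) (x w : space3 R).
Notation lam := (@lebesgue_measure R).

Lemma sum_subsets S (phi : nat -> R) :
  \sum_(K : {set I} | K \subset S) phi #|K| =
  \sum_(k < #|S|.+1) 'C(#|S|, k)%:R * phi k.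
Proof.
rewrite (partition_big (fun K => inord #|K| : 'I_#|S|.+1) predT)//=.
apply: eq_bigr => k _.
rewrite -(cards_draws S k) -sumr_const mulr_suml.
rewrite (eq_bigl (fun K : {set I} => K \in [set A : {set I} | A \subset S & #|A| == k])).
  by apply: eq_bigr => K; rewrite inE => /andP[_ /eqP->]; rewrite mul1r.
move=> K; rewrite inE; case: (boolP (K \subset S)) => //= KS.
by rewrite -val_eqE/= inordK// ltnS subset_leq_card.
Qed.

(** The bound for the points [S] once X = [x] is fixed: [K] collects those in ABXY, of volume q r,
    and the rest lie in AXCY, of volume p r. *)
Definition section_weight S x : R :=
  \sum_(K : {set I} | K \subset S)
    (x.1.2 * slope x) ^+ #|K| * u #|K| *
    ((x.1.1 * slope x) ^+ #|S :\: K| * u #|S :\: K|).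

Lemma measurable_section_weight S : measurable_fun setT (section_weight S).
Proof.
have [m1 m2] := conj (@measurable_coord1 R) (@measurable_coord2 R).
have ms := @measurable_slope R.
rewrite /section_weight; under eq_fun do rewrite big_mkcond.
apply: measurable_sum => K; case: (K \subset S) => //.
apply: measurable_funM; apply: measurable_funM => //; apply: measurable_funX;
  exact: measurable_funM.
Qed.

Lemma simplex_slope_ge0 x : simplex x -> 0 <= slope x.
Proof.
by move=> [x1 x2 x3 x4]; rewrite /slope divr_ge0// mulr_ge0//; lra.
Qed.

Lemma section_weight_ge0 S x : simplex x -> 0 <= section_weight S x.
Proof.
move=> sx; have r0 := simplex_slope_ge0 sx; case: sx => x1 x2 x3 x4.
by apply: sumr_ge0 => K _; rewrite !mulr_ge0// exprn_ge0// mulr_ge0.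
Qed.

(** With N = n - 1, the identity C(N, k) k! (N-k)! = N! gives every k the same constant. The extra
    denominator N + 1 = n is cancelled later by the n choices of X. *)
Lemma integral_section_weight S :
  (\int[lam \x lam \x lam]_(x in simplex) (section_weight S x)%:E =
   (6 / ((#|S|.+3 * #|S|.+2 * #|S|.+1)%:R * #|S|.+1%:R) *
     \sum_(k < #|S|.+1) u k * u (#|S| - k)%N)%:E)%E.
Proof.
set N := #|S|.
pose f K x : R := x.1.2 ^+ #|K| * x.1.1 ^+ #|S :\: K| * slope x ^+ (#|K| + #|S :\: K|).
have mf K : measurable_fun setT (f K).
  have [m1 m2] := conj (@measurable_coord1 R) (@measurable_coord2 R).
  have ms := @measurable_slope R.
  by apply: measurable_funM; [apply: measurable_funM|]; exact: measurable_funX.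
have f0 K x : simplex x -> 0 <= f K x.
  move=> sx; have r0 := simplex_slope_ge0 sx; case: sx => x1 x2 x3 x4.
  by rewrite !mulr_ge0// exprn_ge0.
have mS : measurable (simplex : set (space3 R)) by exact: measurable_simplex.
transitivity (\sum_(K : {set I} | K \subset S)
    \int[lam \x lam \x lam]_(x in simplex) ((u #|K| * u #|S :\: K|)%:E * (f K x)%:E))%E.
  pose h K (x : space3 R) := ((u #|K| * u #|S :\: K|)%:E * (f K x)%:E)%E.
  have mh K : measurable_fun simplex (h K).
    apply/measurable_EFinP; apply: measurable_funM => //.
    exact: measurable_funS (mf K).
  have h0 K x : simplex x -> (0 <= h K x)%E.
    by move=> sx; rewrite /h -EFinM lee_fin; apply: mulr_ge0; [exact: mulr_ge0|exact: f0].
  rewrite -[RHS]big_filter -(@ge0_integral_sum _ _ R (lam \x lam \x lam)%E simplex mS _ h mh h0).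
  apply: eq_integral => x _; rewrite big_filter sumEFin; congr EFin.
  apply: eq_bigr => K _; rewrite /f; move: (slope x) x.1.1 x.1.2 => r p q.
  by rewrite !exprMn exprD; ring.
transitivity (\sum_(K : {set I} | K \subset S)
  (6 * ((#|K|)`!%:R * u #|K| * ((N - #|K|)`!%:R * u (N - #|K|)%N)) /
    (N.+1%:R * (N + 3)`!%:R))%:E)%E.
  apply: eq_bigr => K KS; rewrite ge0_integralZl_EFin//; last 3 first.
  - by move=> x sx; rewrite lee_fin f0.
  - by apply/measurable_EFinP; exact: measurable_funS (mf K).
  - by rewrite mulr_ge0.
  have KE : (#|K| + #|S :\: K| = N)%N by rewrite /N -(cardsID K S) (finset.setIidPr KS).
  have KE2 : #|S :\: K| = (N - #|K|)%N by rewrite -KE addKn.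
  rewrite integral_simplex_slope KE KE2 -EFinM natrM; congr EFin; ring.
rewrite sumEFin; congr EFin.
rewrite (sum_subsets S (fun k => 6 * (k`!%:R * u k * ((N - k)`!%:R * u (N - k)%N)) /
    (N.+1%:R * (N + 3)`!%:R))) mulr_sumr; apply: eq_bigr => k _.
have kN : (k <= N)%N by rewrite -ltnS.
have := bin_fact kN => /(congr1 (fun n => n%:R : R)); rewrite !natrM => bE.
have N0 : N`!%:R != 0 :> R by rewrite pnatr_eq0 -lt0n fact_gt0.
rewrite addn3 !factS !natrM -bE.
have [a0 b0 c0] : [/\ N.+1%:R != 0 :> R, N.+2%:R != 0 :> R & N.+3%:R != 0 :> R].
  by rewrite !pnatr_eq0.
move: N0; rewrite -bE !mulf_eq0 !negb_or => /and3P[b1 b2 b3].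
move: (N.+1%:R) (N.+2%:R) (N.+3%:R) ('C(N, k)%:R) (k`!%:R) ((N - k)`!%:R) a0 b0 c0 b1 b2 b3.
move=> a b c e f' g a0 b0 c0 b1 b2 b3.
by field; rewrite ?a0 ?b0 ?c0 ?b1 ?b2 ?b3.
Qed.

Context d (Omega : measurableType d).
Implicit Types (P : probability Omega R) (V : I -> Omega -> space3 R).

(** [P] and [V] are quantified inside because the induction applies the bound to conditional laws
    and transformed points; both stay on the same [Omega]. *)
Definition good_bound K := forall P V,
  (forall j, j \in K -> measurable_fun setT (V j)) -> rect_law P V K ->
  (P [set omega | good K (fun j => V j omega)] <= (u #|K|)%:E)%E.

(** Several [i] may attain the maximal slope; such overlaps do no harm in a union bound. Genericity
    can be demanded because its failure is a null event. *)
Definition top_position K i v := [/\ good K v, generic (v i) &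
  forall j, j \in K :\ i -> generic (v j) /\ slope (v j) <= slope (v i)].

Lemma measurable_top_position d' (Z : measurableType d') K i (V : I -> Z -> space3 R) :
  i \in K -> (forall j, j \in K -> measurable_fun setT (V j)) ->
  measurable [set z | top_position K i (fun j => V j z)].
Proof.
move=> iK mV.
rewrite (_ : [set z | _] = [set z | good K (fun j => V j z)] `&`
  (V i @^-1` [set x | generic x]) `&`
  \bigcap_(j in [set` K :\ i]) ((V j @^-1` [set x | generic x]) `&`
     [set z | slope (V j z) <= slope (V i z)])); last first.
  apply/seteqP; split=> z /= => [[h1 h2 h3]|[[h1 h2] h3]]; first by split.
  by split.
have mg j : j \in K -> measurable (V j @^-1` [set x | generic x]).
  move=> jK; rewrite -[X in measurable X]setTI.
  by apply: mV => //; exact: measurable_generic.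
apply: measurableI; first by apply: measurableI; [exact: measurable_good|exact: mg].
apply: fin_bigcap_measurable => // j /=; rewrite in_setD1 => /andP[_ jK].
apply: measurableI; first exact: mg.
by apply: measurable_le_set; (apply: measurableT_comp; [exact: measurable_slope|exact: mV]).
Qed.

Lemma probability_plane P V K j (x : space3 R) : j \in K ->
  rect_law P V K ->
  P [set omega | (V j omega).2 = 6 * slope x * (1 - (V j omega).1.1 - (V j omega).1.2)]
  = 0%E.
Proof.
move=> jK VK.
pose A := [set w : space3 R | w.2 = 6 * slope x * (1 - w.1.1 - w.1.2)].
have mA : measurable A.
  have m : measurable_fun setT
      (fun w : space3 R => w.2 - 6 * slope x * (1 - w.1.1 - w.1.2)).
    apply: measurable_funB; first exact: measurable_coord3.
    apply: measurable_funM => //; apply: measurable_funB; last exact: measurable_coord2.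
    by apply: measurable_funB => //; exact: measurable_coord1.
  rewrite (_ : A = setT `&` (fun w : space3 R =>
    w.2 - 6 * slope x * (1 - w.1.1 - w.1.2)) @^-1` [set 0]).
    exact: (m measurableT [set 0]).
  rewrite setTI; apply/seteqP; split=> w; rewrite /A/=; first by move=> ->; rewrite subrr.
  by move/eqP; rewrite subr_eq0 => /eqP.
rewrite -[LHS]/(P [set omega | A (V j omega)]) (rect_law1 jK VK mA).
apply/eqP; rewrite -measure_le0.
apply: (@le_trans _ _ (volume A)).
  apply: le_measure; rewrite ?inE//; apply: measurableI => //; exact: measurable_simplex.
by rewrite [leLHS](volume_graph (fun e : R * R => 6 * slope x * (1 - e.1 - e.2))).
Qed.

(** X is frozen at [x]. The event is covered by the splits of [K :\ i] between the two pieces and by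
    the null events that some point lies on the plane BCX. Within a split the two blocks are
    independent, and the induction hypothesis bounds each. *)
Lemma section_bound P V K i x :
  (forall j, j \in K -> measurable_fun setT (V j)) -> rect_law P V K ->
  i \in K -> generic x ->
  (forall K', (#|K'| < #|K|)%N -> good_bound K') ->
  let y omega j := if j \in [set i]%SET then x else V j omega in
  measurable [set omega | top_position K i (y omega)] ->
  (P [set omega | top_position K i (y omega)] <= (section_weight (K :\ i) x)%:E)%E.
Proof.
move=> mV VK iK gx IH y mE; set S := K :\ i.
have SK : S \subset K by exact: subD1set.
have [p0 q0 s0 _] := gx; have [r0 _ _] := generic_slope gx.
have VS : rect_law P V S by exact: rect_law_sub VK.
have mVS j : j \in S -> measurable_fun setT (V j).
  by move=> jS; apply: mV; exact: (fintype.subsetP SK).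
have SltK K' : K' \subset S -> (#|K'| < #|K|)%N.
  by move=> K'S; rewrite (cardsD1 i K) iK ltnS subset_leq_card.
pose F (t : {set I} + I) : set Omega := match t with
  | inl K' => [set omega | piece (coordsB x) K' (fun j => V j omega) /\
                           piece (coordsC x) (S :\: K') (fun j => V j omega)]
  | inr j => [set omega | (V j omega).2 =
       6 * slope x * (1 - (V j omega).1.1 - (V j omega).1.2)]
  end.
pose p (t : {set I} + I) := match t with inl K' => K' \subset S | inr j => j \in S end.
have mF t : p t -> measurable (F t).
  case: t => [K' K'S|j jS] /=.
    apply: measurableI; apply: measurable_piece.
    - exact: measurable_coordsB.
    - by move=> j /(fintype.subsetP K'S); exact: mVS.
    - exact: measurable_coordsC.
    - by move=> j /finset.setDP[jS _]; exact: mVS.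
  have mj := mVS _ jS.
  have m : measurable_fun setT (fun omega => (V j omega).2 -
      6 * slope x * (1 - (V j omega).1.1 - (V j omega).1.2)).
    apply: measurable_funB; first exact: (measurableT_comp measurable_coord3 mj).
    apply: measurable_funM => //; apply: measurable_funB.
      apply: measurable_funB => //; exact: (measurableT_comp measurable_coord1 mj).
    exact: (measurableT_comp measurable_coord2 mj).
  rewrite (_ : [set _ | _] = setT `&` (fun omega => (V j omega).2 -
      6 * slope x * (1 - (V j omega).1.1 - (V j omega).1.2)) @^-1` [set 0]).
    exact: (m measurableT [set 0]).
  rewrite setTI; apply/seteqP; split=> w /=; first by move=> ->; rewrite subrr.
  by move/eqP; rewrite subr_eq0 => /eqP.
have cover omega : top_position K i (y omega) -> exists2 t, p t & F t omega.
  move=> [gK _ gS].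
  have yV j : j \in S -> y omega j = V j omega.
    by rewrite /y !inE => /andP[/negbTE->].
  have yi : y omega i = x by rewrite /y inE eqxx.
  have [[j jS jp]|np] := pselect (exists2 j, j \in S & F (inr j) omega).
    by exists (inr j).
  (* A point lying in both pieces is counted in [K'], so that the two blocks are disjoint. *)
  pose K' := [set j in S | `[< simplex (coordsB x (V j omega)) >]]%SET.
  have K'S : K' \subset S by apply/fintype.subsetP => j; rewrite inE => /andP[].
  pose H := [set y omega k | k in [set` K]] `|` floorABC R.
  have Hx : H x by left; exists i.
  have fH : floorABC R `<=` H by right.
  have notint j : j \in S -> ~ interior (convex_hull H) (V j omega).
    by move=> jS; rewrite -yV//; apply: gK; exact: (fintype.subsetP SK).
  exists (inl K') => //; split; split.
  - by move=> j; rewrite inE => /andP[_ /asboolP].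
  - move=> j jK'; have jS := fintype.subsetP K'S _ jK'.
    move=> hj; apply: (notint j jS).
    apply: (interior_coordsB gx Hx fH _ hj) => _ [k /= kK' <-].
    exists (V k omega) => //; left; exists k => /=.
      exact: (fintype.subsetP SK _ (fintype.subsetP K'S _ kK')).
    by rewrite yV// (fintype.subsetP K'S).
  - move=> j /finset.setDP[jS jK'].
    (* A point outside both pieces would be interior to ABCX, hence to the hull. *)
    have nB : ~ simplex (coordsB x (V j omega)).
      by move=> h; move/negP: jK'; apply; rewrite inE jS; apply/asboolP.
    apply: contrapT => nC; apply: (notint j jS).
    have [gj sj] := gS j jS; rewrite yV// yi in gj sj.
    have [_ _ wj swj] := gj.
    have [rj _ sEj] := generic_slope gj.
    apply: (@interior_tetrahedron R (convex_hull H) x) => //.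
    + exact: convex_hull_convex.
    + by move=> w fw; apply: sub_convex_hull; right.
    + exact: sub_convex_hull.
    (* Maximality of the slope of X gives the inequality, and [np] excludes equality. *)
    + rewrite lt_neqAle; apply/andP; split.
        by apply/eqP => e; apply: np; exists j.
      have c0 : 0 < 1 - (V j omega).1.1 - (V j omega).1.2.
        by case: swj => _ _ _; lra.
      by rewrite {1}sEj ler_pM2r// ler_pM2l.
  - move=> j jD; have /finset.setDP[jS jK'] := jD.
    move=> hj; apply: (notint j jS).
    apply: (interior_coordsC gx Hx fH _ hj) => _ [k /= kD <-].
    have /finset.setDP[kS _] := kD.
    exists (V k omega) => //; left; exists k => /=.
      exact: (fintype.subsetP SK).
    by rewrite yV.
apply: le_trans (measure_cover_le P mE mF cover) _.
rewrite big_sumType/= [X in (_ + X)%E]big1 ?adde0; last first.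
  by move=> j jS; exact: (probability_plane _ jS VS).
rewrite /section_weight -sumEFin; apply: lee_sum => K' K'S.
have mid : forall j, j \in S -> measurable_fun setT
    (fun v : g_sigma_algebraType (rects (R := R) S) => (v : I -> space3 R) j).
  by move=> j; exact: measurable_family_coord.
rewrite (@independent_blocks R I _ _ P V S mVS VS K' (piece (coordsB x) K')
  (piece (coordsC x) (S :\: K'))).
- rewrite EFinM; apply: lee_pmul.
  + exact: measure_ge0.
  + exact: measure_ge0.
  + rewrite EFinM; apply: probability_piece.
    * by move=> j /(fintype.subsetP K'S); exact: mVS.
    * exact: rect_law_sub VS.
    * exact: measurable_coordsB.
    * by rewrite mulr_gt0.
    * by move=> A mA; exact: volume_shear1.
    * by move=> w; exact: coordsB_sub.
    * exact: (IH _ (SltK _ K'S)).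
  + rewrite EFinM; apply: probability_piece.
    * by move=> j /finset.setDP[jS _]; exact: mVS.
    * by apply: rect_law_sub VS; exact: finset.subsetDl.
    * exact: measurable_coordsC.
    * by rewrite mulr_gt0.
    * by move=> A mA; exact: volume_shear2.
    * by move=> w; exact: coordsC_sub.
    * exact: (IH _ (SltK _ (finset.subsetDl _ _))).
- by move=> v v'; exact: piece_ext.
- move=> v v' vv'; apply: piece_ext => j /finset.setDP[_ jK']; exact: vv'.
- apply: (@measurable_piece R I _ (g_sigma_algebraType (rects (R := R) S)) _ _
    (fun j (v : I -> space3 R) => v j)).
    exact: measurable_coordsB.
  by move=> j /(fintype.subsetP K'S); exact: mid.
- apply: (@measurable_piece R I _ (g_sigma_algebraType (rects (R := R) S)) _ _
    (fun j (v : I -> space3 R) => v j)).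
    exact: measurable_coordsC.
  by move=> j /finset.setDP[jS _]; exact: mid.
Qed.

(** Decoupling at the single index [i] puts X and the other points on separate copies of the sample
    space. Fubini bounds each section by [section_weight] at X, and uniformity of X turns the outer
    integral into one over [simplex]. *)
Lemma probability_top_position P V K i :
  (forall j, j \in K -> measurable_fun setT (V j)) -> rect_law P V K ->
  i \in K -> (forall K', (#|K'| < #|K|)%N -> good_bound K') ->
  (P [set omega | top_position K i (fun j => V j omega)] <=
   (6 / ((#|K| + 2) * (#|K| + 1) * #|K|)%:R / #|K|%:R *
     \sum_(0 <= k < #|K|) u k * u (#|K| - 1 - k)%N)%:E)%E.
Proof.
move=> mV VK iK IH.
have KE : #|K| = #|K :\ i|.+1 by rewrite (cardsD1 i K) iK.
have mT : measurable ([set v | top_position K i v] : set (g_sigma_algebraType (rects (R := R) K))).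
  apply: (@measurable_top_position _ (g_sigma_algebraType (rects (R := R) K)) K i
    (fun j (v : I -> space3 R) => v j)) => // j jK.
  exact: measurable_family_coord.
have mVi := mV _ iK.
rewrite (decouple mV VK [set i] mT).
set E := [set omega | _].
have mE : measurable E.
  apply: (measurable_top_position (V := fun j omega => merge V [set i] omega j)) => // j jK.
  exact: (measurable_merge mV).
have -> : (P \x P)%E E = (\int[P]_omega (P (xsection E omega)))%E by [].
have mS : measurable (simplex : set (space3 R)) by exact: measurable_simplex.
have mViS : measurable (V i @^-1` simplex).
  by rewrite -[X in measurable X]setTI; exact: mVi.
have mw : measurable_fun setT (fun x => (section_weight (K :\ i) x)%:E).
  by apply/measurable_EFinP; exact: measurable_section_weight.
apply: (@le_trans _ _ (\int[P]_(omega in V i @^-1` simplex)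
    (section_weight (K :\ i) (V i omega))%:E)%E).
  rewrite [leRHS]integral_mkcond; apply: ge0_le_integral => //.
  - exact: measurable_fun_xsection.
  - apply/(measurable_restrictT _ _).1 => //.
    by apply: measurable_funTS; exact: (measurableT_comp mw mVi).
  - move=> omega _.
    have sE : xsection E omega = [set omega2 | top_position K i
        (fun j => if j \in [set i]%SET then V i omega else V j omega2)].
      rewrite xsectionE; apply/funext => omega2 /=; rewrite /E /merge/=.
      congr (top_position K i _); apply/funext => j.
      by case: ifP => //; rewrite inE => /eqP ->.
    have [gx|ng] := pselect (generic (V i omega)).
      rewrite patchE (_ : omega \in V i @^-1` simplex); last by rewrite inE; case: gx.
      rewrite sE; apply: section_bound => //.
      by rewrite -sE; exact: measurable_xsection.
    (* If X is not generic the section is empty, since [top_position] requires a generic top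
       point. *)
    rewrite sE (_ : [set _ | _] = set0).
      by rewrite measure0; apply: erestrict_ge0 => ? ?; rewrite lee_fin section_weight_ge0.
    by apply/seteqP; split=> // o2 [_]; rewrite inE eqxx.
have -> : (\int[P]_(omega in V i @^-1` simplex)
    (section_weight (K :\ i) (V i omega))%:E =
    \int[lam \x lam \x lam]_(x in simplex) (section_weight (K :\ i) x)%:E)%E.
  rewrite -(@ge0_integral_pushforward _ _ Omega
    (measurableTypeR R * measurableTypeR R * measurableTypeR R)%type R (V i) mVi P
    simplex (fun x => (section_weight (K :\ i) x)%:E))//.
  - apply: eq_measure_integral => A mA AS.
    have := rect_law1 iK VK mA; rewrite (setIidl AS); exact.
  - exact: measurable_funS mw.
  - by move=> x; rewrite inE => sx; rewrite lee_fin section_weight_ge0.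
rewrite integral_section_weight lee_fin KE addn2 addn1.
rewrite invfM mulrA big_mkord le_eqVlt; apply/orP; left; apply/eqP.
by congr (_ * _); apply: eq_bigr => k _; rewrite subn1.
Qed.

End recursion.

(** * Induction on the number of points *)

Section upper_bound.
Context {R : realType} {I : finType} (u : nat -> R).
Hypothesis hu0 : u 0%N = 1.
Hypothesis hu : forall n : nat, (1 <= n)%N ->
  u n = 6 / ((n + 2) * (n + 1) * n)%:R
        * \sum_(0 <= k < n) u k * u (n - 1 - k)%N.

Lemma recursion_ge0 n : 0 <= u n.
Proof.
elim/ltn_ind: n => -[|n] IH; first by rewrite hu0.
rewrite hu// mulr_ge0// ?divr_ge0// big_mkord; apply: sumr_ge0 => k _.
by rewrite mulr_ge0// IH// subn1/= ltnS leq_subr.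
Qed.

Context d (Omega : measurableType d).

(** Up to null events all points are generic and one of them has maximal slope; the union bound over
    which one it is gives [#|K|] equal terms. *)
Lemma good_bound_recursion (K : {set I}) : good_bound u Omega K.
Proof.
have [m] := ubnP #|K|; elim: m K => // m IHm K; rewrite ltnS => Km P V mV VK.
have IH (K' : {set I}) : (#|K'| < #|K|)%N -> good_bound u Omega K'.
  by move=> K'K; apply: IHm; exact: leq_trans Km.
set E := [set omega | _].
have mE : measurable E by exact: measurable_good.
have [K0|K0] := posnP #|K|.
  by rewrite K0 hu0; exact: probability_le1.
pose F (t : I + I) : set Omega := match t with
  | inl j => [set omega | ~ generic (V j omega)]
  | inr i => [set omega | top_position K i (fun j => V j omega)]
  end.
pose p (t : I + I) := match t with inl j => j \in K | inr j => j \in K end.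
have mng : measurable (~` [set x : space3 R | generic x]).
  by apply: measurableC; exact: measurable_generic.
have mF t : p t -> measurable (F t).
  case: t => j jK; last exact: measurable_top_position.
  by have := mV j jK measurableT _ mng; rewrite setTI.
have cover omega : E omega -> exists2 t, p t & F t omega.
  move=> gK.
  have [[j jK jp]|gen] := pselect (exists2 j, j \in K & ~ generic (V j omega)).
    by exists (inl j).
  have {}gen j : j \in K -> generic (V j omega).
    by move=> jK; apply: contrapT => ng; apply: gen; exists j.
  have [i0 i0K] : exists i, i \in K by apply/card_gt0P.
  have [i iK imax] := @arg_maxP _ _ _ i0 (mem K) (fun j => slope (V j omega)) i0K.
  exists (inr i) => //; split=> //; first exact: gen.
  move=> j; rewrite in_setD1 => /andP[_ jK]; split; first exact: gen.
  exact: imax.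
apply: le_trans (measure_cover_le P mE mF cover) _.
rewrite big_sumType/= [X in (X + _)%E]big1 ?add0e; last first.
  by move=> j jK; rewrite (rect_law1 jK VK mng) volume_nongeneric.
apply: (@le_trans _ _ (\sum_(i in K) (6 / ((#|K| + 2) * (#|K| + 1) * #|K|)%:R / #|K|%:R *
     \sum_(0 <= k < #|K|) u k * u (#|K| - 1 - k)%N)%:E)%E).
  apply: lee_sum => i iK; apply: probability_top_position => //.
  exact: recursion_ge0.
rewrite sumEFin sumr_const hu// lee_fin le_eqVlt; apply/orP; left; apply/eqP.
(* The number of terms cancels the factor [1 / #|K|] carried by each. *)
rewrite -[LHS]mulr_natl.
have : #|K|%:R != 0 :> R by rewrite pnatr_eq0 -lt0n.
set S := \sum_(_ <= _ < _) _; move: ((#|K| + 2) * (#|K| + 1) * #|K|)%:R^-1 => a n0.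
by rewrite mulrA; congr (_ * _); field.
Qed.

End upper_bound.

(** * From boundary points to convex position, and the conclusion *)

Lemma Q_T_good (d : measure_display) (Omega : measurableType d)
    (R : realType) (P : probability Omega R) (n : nat)
    (U : 'I_n -> {RV P >-> space3 R}) :
  Q_T P U = P [set w | good [set: 'I_n]%SET (fun j => U j w)].
Proof.
congr (P _); apply/funext => w; apply/propext.
have E : [set U j w | j in [set: 'I_n]] = [set U k w | k in [set` [set: 'I_n]%SET]].
  by apply/seteqP; split=> _ [k _ <-]; exists k => //=; rewrite inE.
rewrite /good /= -E; split=> H i; first by move=> _; have [] := H i.
split; last by apply: H; rewrite inE.
by apply: subset_closure; apply: sub_convex_hull; left; exists i.
Qed.

Theorem theorem7 (R : realType) (u : nat -> R)
  (hu0 : u 0%N = 1)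
  (hu : forall n : nat, (1 <= n)%N ->
     u n = 6 / ((n + 2) * (n + 1) * n)%:R
           * \sum_(0 <= k < n) u k * u (n - 1 - k)%N)
  (n : nat) (d : measure_display) (Omega : measurableType d)
  (P : probability Omega R) (U : 'I_n -> {RV P >-> space3 R})
  (hindep : independent P U)
  (hunif : forall i : 'I_n, uniform_on P (tetrahedron R) (U i)) :
  (Q_T P U <= (u n)%:E)%E.
Proof.
rewrite Q_T_good -[in leRHS](card_ord n) -cardsT.
apply: (good_bound_recursion hu0 hu) => [j _|A mA]; first exact: measurable_funPT.
have mAi (i : 'I_n) : i \in [set: 'I_n]%SET -> measurable (A i) by [].
transitivity (\prod_(i in [set: 'I_n]%SET) P (U i @^-1` A i))%E.
  by rewrite -(hindep [set: 'I_n]%SET A mAi); congr (P _); apply/seteqP; split.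
apply: eq_bigr => i _.
(* T has volume 1, so the quotient in [uniform_on] reduces to its numerator. *)
have := hunif i (A i) (mA i).
by rewrite tetrahedronE volume_simplex inve1 mule1.
Qed.
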